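(* Let $(\xi,a,\omega)$ be shear data on a smooth manifold $M$, let $(P,\theta,\rho)$ be a shear total space for $\omega$ with projection $\pi\colon P\to M$, and suppose that the shear $S=P/\mathring\xi(\pi^*E)$ is smooth, with projection $\pi_S\colon P\to S$. Let $\alpha\in\Omega^kM$ be a $k$-form on $M$ with $\mathcal{L}^\nabla_\xi\alpha=0$ and let $\alpha_S\in\Omega^kS$ be such that $\alpha\sim_{\mathcal{H}}\alpha_S$. Then $$d\alpha-\bigl(\xi\circ a^{-1}\lrcorner\,\alpha\bigr)\wedge\omega\ \sim_{\mathcal{H}}\ d\alpha_S.$$
   Context: All flat connections and the induced connections on tensor products, duals and pull-backs are denoted $\nabla$; $d^\nabla$ is the covariant exterior derivative. For a bundle map $\zeta\colon V\to TM$ and a $k$-form $\beta$ with values in $W$, $\zeta\lrcorner\,\beta$ is the $(k-1)$-form with values in $V^*\otimes W$ given by $(\zeta\lrcorner\,\beta)(X_2,\dots,X_k)(v)=\beta(\zeta v,X_2,\dots,X_k)$, and $\mathcal{L}^\nabla_\xi\beta=d^\nabla(\xi\lrcorner\,\beta)+\xi\lrcorner\,d^\nabla\beta$ for $\xi\colon E\to TM$. In $(\xi\circ a^{-1}\lrcorner\,\alpha)\wedge\omega$ the $F^*$-valued $(k-1)$-form $\xi\circ a^{-1}\lrcorner\,\alpha$ is wedged with the $F$-valued two-form $\omega$ using the natural pairing of $F^*$ and $F$. Shear data on $M$: a triple $(\xi,a,\omega)$ where $E,F\to M$ are flat vector bundles of the same rank, $\xi\colon E\to TM$ is a bundle map,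 $a\colon E\to F$ is an invertible bundle morphism and $\omega\in\Omega^2(M,F)$, such that (i) $\xi(\nabla_{\xi e_1}e_2-\nabla_{\xi e_2}e_1)=[\xi e_1,\xi e_2]$ for all $e_1,e_2\in\Gamma(E)$; (ii) $d^\nabla\omega=0$; (iii) $\xi\lrcorner\,\omega=-d^\nabla a$; (iv) $\xi^*\omega=0$. Shear total space $(P,\theta,\rho)$ for $\omega$: $P$ is a manifold with a foliation with (connected) leaves of dimension $\operatorname{rk}F$ and leaf space $M$, $\pi\colon P\to M$ is the projection, a surjective submersion; $\rho\colon\pi^*F\to TP$ is a bundle morphism and $\theta\in\Omega^1(P,\pi^*F)$, with $\theta\circ\rho=\mathrm{id}_{\pi^*F}$, $d\pi\circ\rho=0$, $d^\nabla\theta=\pi^*\omega$. Put $\mathcal{H}=\ker\theta$, so $TP=\mathcal{H}\oplus\ker d\pi$. Shear: with $\tilde\xi\colon\pi^*E\to\mathcal{H}$ the horizontal lift of $\xi$, put $\mathring\xi=\tilde\xi+\rho\circ\pi^*a\colon\pi^*E\to TP$; $\mathring\xi(\pi^*E)$ is an integrable distribution of constant rank, and $S=P/\mathring\xi(\pi^*E)$ is its leaf space. Forms $\beta$ on $M$ and $\beta_S$ on $S$ are $\mathcal{H}$-related ($\beta\sim_{\mathcal{H}}\beta_S$) if $\pi^*\beta|_{\mathcal{H}}=\pi_S^*\beta_S|_{\mathcal{H}}$. *)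

(* Defs.v *)
From HB Require Import structures.
From mathcomp Require Import all_boot all_order all_algebra all_fingroup.
From mathcomp Require Import all_classical all_reals all_analysis.

Set Implicit Arguments.
Unset Strict Implicit.
Unset Printing Implicit Defensive.
Import Order.TTheory GRing.Theory Num.Theory numFieldNormedType.Exports.
Local Open Scope classical_set_scope.
Local Open Scope ring_scope.

(* Class C^k on an open subset U of a finite-dimensional normed space. *)
Fixpoint Ck_on (R : realType) (V W : normedModType R) (k : nat) (U : set V)
    (f : V -> W) : Prop :=
  if k is j.+1 then
    (forall z, U z -> differentiable f z) /\
    (forall v, Ck_on j U (fun z => 'D_v f z))
  else forall z, U z -> {for z, continuous f}.

Definition smooth_near (R : realType) (V W : normedModType R)
    (f : V -> W) (z : V) : Prop :=
  exists2 U : set V, open_nbhs z U & forall k, Ck_on k U f.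

(* A smooth n-manifold, given by an atlas indexed by the points: [phi x] is a
   chart with domain [dom x] around x, and [psi x] is its inverse. *)
Record manifold (R : realType) (n : nat) := Manifold {
  carrier :> topologicalType;
  dom : carrier -> set carrier;
  phi : carrier -> carrier -> 'rV[R]_n;
  psi : carrier -> 'rV[R]_n -> carrier;
  manifold_hausdorff : hausdorff_space carrier;
  manifold_second_countable : @second_countable carrier;
  dom_open : forall x, open (dom x);
  dom_self : forall x, dom x x;
  phi_dom_open : forall x, open (phi x @` dom x);
  phiK : forall x y, dom x y -> psi x (phi x y) = y;
  phi_continuous : forall x y, dom x y -> {for y, continuous (phi x)};
  psi_continuous : forall x z, (phi x @` dom x) z -> {for z, continuous (psi x)};
  chart_compat : forall x y k,
    Ck_on k (phi x @` (dom x `&` dom y)) (phi y \o psi x)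
}.

(* The tangent space T_xM is 'rV_n: a tangent vector at x is identified with its
   coordinates in the chart at x.  A vector field is X : M -> 'rV_n, where X y is
   to be read in the chart at y. *)

Section Calculus.
Context (R : realType) (n : nat) (M : manifold R n).

Definition msmooth_near (W : normedModType R) (f : M -> W) (x : M) : Prop :=
  smooth_near (f \o psi x) (phi x x).

(* derivative at x of f, in the direction v in T_xM *)
Definition mderiv (W : normedModType R) (f : M -> W) (x : M) (v : 'rV[R]_n) : W :=
  'D_v (f \o psi x) (phi x x).

End Calculus.

Section SmoothMaps.
Context (R : realType) (m n : nat) (P : manifold R m) (N : manifold R n).

Definition smooth_map (q : P -> N) : Prop :=
  continuous q /\ forall p, msmooth_near (phi (q p) \o q) p.

(* the differential T_pP -> T_{q p}N *)
Definition dmap (q : P -> N) (p : P) (v : 'rV[R]_m) : 'rV[R]_n :=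
  mderiv (phi (q p) \o q) p v.

End SmoothMaps.

(* Fibres and, for each point x, a family of maps over a neighbourhood [tdom x]
   of x, meant to be a local trivialization.  The bundle axioms are separate, so
   that TM and pull-backs are available as plain data. *)
Record bundle_data (R : realType) (n : nat) (M : manifold R n) (r : nat) :=
  BundleData {
    fib :> M -> vectType R;
    tdom : M -> set M;
    triv : M -> forall y : M, 'Hom(fib y, 'rV[R]_r)
  }.

Section Bundles.
Context (R : realType) (n : nat) (M : manifold R n) (r : nat).
Implicit Type B : bundle_data M r.

Definition section_smooth_near B (s : forall y, B y) (x : M) : Prop :=
  msmooth_near (fun y => triv B x y (s y)) x.

(* the local section through e that is constant in the trivialization at x *)
Definition const_ext B (x : M) (e : B x) : forall y, B y :=
  fun y => (triv B x y)^-1%VF (triv B x x e).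

Record is_vector_bundle B : Prop := IsVectorBundle {
  tdom_open : forall x, open (tdom B x);
  tdom_self : forall x, tdom B x x;
  triv_inj : forall x y, tdom B x y -> lker (triv B x y) = 0%VS;
  triv_surj : forall x y, tdom B x y -> limg (triv B x y) = fullv;
  triv_compat : forall x y z (u : 'rV[R]_r), tdom B x z -> tdom B y z ->
    msmooth_near (fun w => triv B y w ((triv B x w)^-1%VF u)) z
}.

End Bundles.

Definition tangent (R : realType) (n : nat) (M : manifold R n) : bundle_data M n :=
  @BundleData R n M n (fun _ => 'rV[R]_n : vectType R) (@dom R n M)
    (fun x y => linfun (fun v : 'rV[R]_n => mderiv (phi x) y v)).

Definition trivial_line (R : realType) (n : nat) (M : manifold R n) :
    bundle_data M 1 :=
  @BundleData R n M 1 (fun _ => R^o : vectType R) (fun _ => setT)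
    (fun x y => linfun (fun c : R^o => const_mx c : 'rV[R]_1)).

Definition pullback_bundle (R : realType) (m n r : nat) (P : manifold R m)
    (M : manifold R n) (q : P -> M) (B : bundle_data M r) : bundle_data P r :=
  @BundleData R m P r (fun p => B (q p)) (fun p => q @^-1` tdom B (q p))
    (fun p p' => triv B (q p) (q p')).

(* Both fields are read in the chart at x, where [X,Y] = D_X Y - D_Y X. *)
Definition lie_bracket (R : realType) (n : nat) (M : manifold R n)
    (X Y : forall y : M, tangent M y) (x : M) : tangent M x :=
  mderiv (fun y => triv (tangent M) x y (Y y)) x (X x) -
  mderiv (fun y => triv (tangent M) x y (X y)) x (Y x).

Definition bundle_map_smooth (R : realType) (n : nat) (M : manifold R n)
    (r1 r2 : nat) (A : bundle_data M r1) (B : bundle_data M r2)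
    (f : forall x, 'Hom(A x, B x)) : Prop :=
  forall x (s : forall y, A y), section_smooth_near s x ->
    section_smooth_near (fun y => f y (s y)) x.

(* [nabla x v s] is the covariant derivative at x of the section s in the
   direction v in T_xM; it is only meaningful for s smooth near x. *)
Definition connection (R : realType) (n : nat) (M : manifold R n)
    (W : M -> vectType R) :=
  forall x : M, 'rV[R]_n -> (forall y, W y) -> W x.

Record is_flat_connection (R : realType) (n : nat) (M : manifold R n) (r : nat)
    (B : bundle_data M r) (nabla : connection B) : Prop := IsFlatConnection {
  conn_linear : forall x (c : R) (u v : 'rV[R]_n) (s : forall y, B y),
    section_smooth_near s x ->
    nabla x (c *: u + v) s = c *: nabla x u s + nabla x v s;
  conn_add : forall x (v : 'rV[R]_n) (s t : forall y, B y),
    section_smooth_near s x -> section_smooth_near t x ->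
    nabla x v (fun y => s y + t y) = nabla x v s + nabla x v t;
  conn_leibniz : forall x (v : 'rV[R]_n) (f : M -> R^o) (s : forall y, B y),
    msmooth_near f x -> section_smooth_near s x ->
    nabla x v (fun y => f y *: s y) = mderiv f x v *: s x + f x *: nabla x v s;
  conn_local : forall x (v : 'rV[R]_n) (s t : forall y, B y),
    section_smooth_near s x -> (\forall y \near x, s y = t y) ->
    nabla x v s = nabla x v t;
  conn_smooth : forall x (X : forall y, tangent M y) (s : forall y, B y),
    section_smooth_near X x -> section_smooth_near s x ->
    section_smooth_near (fun y => nabla y (X y) s) x;
  conn_flat : forall x (X Y : forall y, tangent M y) (s : forall y, B y),
    section_smooth_near X x -> section_smooth_near Y x ->
    section_smooth_near s x ->
    nabla x (X x) (fun y => nabla y (Y y) s) -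
    nabla x (Y x) (fun y => nabla y (X y) s) -
    nabla x (lie_bracket X Y x) s = 0
}.

Record flat_bundle (R : realType) (n : nat) (M : manifold R n) (r : nat) :=
  FlatBundle {
    flat_data :> bundle_data M r;
    nabla : connection flat_data;
    flat_is_vector_bundle : is_vector_bundle flat_data;
    flat_is_flat : is_flat_connection nabla
  }.

Arguments nabla {R n M r} f.

Section InducedConnections.
Context (R : realType) (n : nat) (M : manifold R n).

Definition hom_fib (V W : M -> vectType R) : M -> vectType R :=
  fun x => 'Hom(V x, W x) : vectType R.

Definition real_fib : M -> vectType R := fun _ => R^o : vectType R.

Definition real_connection : connection real_fib :=
  fun x v f => mderiv (f : M -> R^o) x v.

(* V^* (x) W is rendered as Hom(V, W), with (nabla_v A)(e) = nabla_v (A e) -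
   A (nabla_v e) for any local section extending e. *)
Definition hom_connection (r : nat) (V : bundle_data M r) (W : M -> vectType R)
    (DV : connection V) (DW : connection W) : connection (hom_fib V W) :=
  fun x v A => linfun (fun e : V x =>
    DW x v (fun y => (A y : 'Hom(V y, W y)) (const_ext e y)) -
    (A x : 'Hom(V x, W x)) (DV x v (const_ext e))).

End InducedConnections.

(* If s = sum_i s^i (e_i o q) with (e_i) the frame of B given by the trivialization
   at q p, then nabla_v s = sum_i v(s^i) e_i(q p) + s^i(p) nabla_{dq v} e_i. *)
Definition pullback_connection (R : realType) (m n r : nat) (P : manifold R m)
    (M : manifold R n) (q : P -> M) (B : bundle_data M r) (D : connection B) :
    connection (pullback_bundle q B) :=
  fun p v s =>
    (triv B (q p) (q p))^-1%VF
      (mderiv (fun p' => triv B (q p) (q p') (s p')) p v) +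
    D (q p) (dmap q p v) (const_ext (s p : B (q p))).

(* k-forms with values in the fibres W; multilinearity, alternation and smoothness
   are in [is_form]. *)
Definition vform (R : realType) (n : nat) (M : manifold R n) (k : nat)
    (W : M -> vectType R) :=
  forall x : M, ('I_k -> 'rV[R]_n) -> W x.

Section Forms.
Context (R : realType) (n : nat) (M : manifold R n).

Definition upd (k : nat) (X : 'I_k -> 'rV[R]_n) (i : 'I_k) (u : 'rV[R]_n) :
    'I_k -> 'rV[R]_n :=
  fun j => if j == i then u else X j.

Definition vcons (k : nat) (u : 'rV[R]_n) (X : 'I_k -> 'rV[R]_n) :
    'I_k.+1 -> 'rV[R]_n :=
  fun i => if unlift ord0 i is Some j then X j else u.

Record is_form (r k : nat) (B : bundle_data M r) (beta : vform k B) : Prop :=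
  IsForm {
    form_linear : forall x X i (c : R) (u v : 'rV[R]_n),
      beta x (upd X i (c *: u + v)) =
        c *: beta x (upd X i u) + beta x (upd X i v);
    form_alternating : forall x X i j, i != j -> X i = X j -> beta x X = 0;
    form_smooth : forall x (X : 'I_k -> forall y, tangent M y),
      (forall i, section_smooth_near (X i) x) ->
      section_smooth_near (fun y => beta y (fun i => X i y)) x
  }.

(* The invariant formula for d^nabla, on coordinate vector fields of the chart at x,
   for which the bracket terms vanish. *)
Definition ext_deriv (W : M -> vectType R) (D : connection W) (k : nat)
    (beta : vform k W) : vform k.+1 W :=
  fun x X => \sum_(i < k.+1) (-1) ^+ i *:
    D x (X i) (fun y => beta y (fun j : 'I_k =>
      const_ext (X (lift i j) : tangent M x) y)).

Definition contract (r k : nat) (V : bundle_data M r) (W : M -> vectType R)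
    (zeta : forall x, 'Hom(V x, 'rV[R]_n)) (beta : vform k.+1 W) :
    vform k (hom_fib V W) :=
  fun x X => linfun (fun v : V x => beta x (vcons (zeta x v) X)).

(* On 0-forms the contraction is zero, so only xi _| d beta remains. *)
Definition lie_deriv (r k : nat) (V : bundle_data M r) (DV : connection V)
    (W : M -> vectType R) (DW : connection W)
    (xi : forall x, 'Hom(V x, 'rV[R]_n)) : vform k W -> vform k (hom_fib V W) :=
  match k with
  | 0 => fun beta => contract xi (ext_deriv DW beta)
  | j.+1 => fun beta x X =>
      ext_deriv (hom_connection DV DW) (contract xi beta) x X +
      contract xi (ext_deriv DW beta) x X
  end.

(* wedge product using the natural pairing of V^* and V, normalized as a sum over
   shuffles *)
Definition wedge_pairing (V : M -> vectType R) (j l m : nat) (jl : (j + l)%N = m)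
    (mu : vform j (hom_fib V (@real_fib R n M))) (omega : vform l V) :
    vform m (@real_fib R n M) :=
  fun x X => (j`! * l`!)%:R^-1 * \sum_(s : 'S_m) (-1) ^+ s *
    (mu x (fun i => X (s (cast_ord jl (lshift l i)))) : 'Hom(V x, R^o))
      (omega x (fun i => X (s (cast_ord jl (rshift j i))))).

(* (zeta _| alpha) /\ omega, which is zero when alpha is a 0-form *)
Definition contract_wedge (r k : nat) (V : bundle_data M r)
    (zeta : forall x, 'Hom(V x, 'rV[R]_n)) (omega : vform 2 V) :
    vform k (@real_fib R n M) -> vform k.+1 (@real_fib R n M) :=
  match k with
  | 0 => fun _ _ _ => 0
  | j.+1 => fun alpha => wedge_pairing (addn2 j) (contract zeta alpha) omega
  end.

End Forms.

(* ordinary real-valued forms and the ordinary exterior derivative *)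
Definition rform (R : realType) (n : nat) (M : manifold R n) (k : nat) :=
  vform k (@trivial_line R n M).

Definition ext_d (R : realType) (n : nat) (M : manifold R n) (k : nat)
    (alpha : rform M k) : rform M k.+1 :=
  ext_deriv (@real_connection R n M) alpha.

Definition pullback_form (R : realType) (m n k : nat) (P : manifold R m)
    (N : manifold R n) (q : P -> N) (W : N -> vectType R) (beta : vform k W) :
    vform k (fun p : P => W (q p)) :=
  fun p X => beta (q p) (fun i => dmap q p (X i)).

Section LeafSpaces.
Context (R : realType) (m : nat) (P : manifold R m).

Definition curve_smooth (c : R^o -> P) : Prop :=
  continuous c /\ forall t, smooth_near (phi (c t) \o c) t.

Definition velocity (c : R^o -> P) (t : R^o) : 'rV[R]_m :=
  'D_(1 : R^o) (phi (c t) \o c) t.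

(* The leaves of an integrable distribution are the sets of points that can be
   joined by smooth curves tangent to the distribution. *)
Definition same_leaf (D : P -> set 'rV[R]_m) (p p' : P) : Prop :=
  exists c : R^o -> P, [/\ curve_smooth c, c 0 = p, c 1 = p' &
    forall t, D (c t) (velocity c t)].

(* q identifies the smooth manifold N with the leaf space of the foliation of P
   with tangent distribution D. *)
Record is_leaf_space (n : nat) (N : manifold R n) (D : P -> set 'rV[R]_m)
    (q : P -> N) : Prop := IsLeafSpace {
  leaf_smooth : smooth_map q;
  leaf_surjective : forall y, exists p, q p = y;
  leaf_submersion : forall p w, exists v, dmap q p v = w;
  leaf_tangent : forall p v, D p v <-> dmap q p v = 0;
  leaf_fibres : forall p p', q p = q p' <-> same_leaf D p p'
}.

End LeafSpaces.

Section Shears.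
Context (R : realType) (n r : nat) (M : manifold R n) (E F : flat_bundle M r).

Record shear_data (xi : forall x, 'Hom(E x, 'rV[R]_n))
    (a : forall x, 'Hom(E x, F x)) (omega : vform 2 F) : Prop := ShearData {
  shear_xi_smooth : @bundle_map_smooth R n M r n E (tangent M) xi;
  shear_a_smooth : bundle_map_smooth a;
  shear_a_inj : forall x, lker (a x) = 0%VS;
  shear_a_surj : forall x, limg (a x) = fullv;
  shear_omega_form : is_form omega;
  shear_bracket : forall e1 e2 : (forall y, E y),
    (forall x, section_smooth_near e1 x) ->
    (forall x, section_smooth_near e2 x) ->
    forall x, xi x (nabla E x (xi x (e1 x)) e2 - nabla E x (xi x (e2 x)) e1) =
      lie_bracket (fun y => xi y (e1 y)) (fun y => xi y (e2 y)) x;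
  shear_closed : forall x X, ext_deriv (nabla F) omega x X = 0;
  (* a is a 0-form with values in E^* (x) F *)
  shear_contract : forall x X,
    contract xi omega x X =
    - ext_deriv (W := hom_fib E F)
        (hom_connection (nabla E) (nabla F))
        (fun y (_ : 'I_0 -> 'rV[R]_n) => a y) x X;
  shear_isotropic : forall x (e : 'I_2 -> E x),
    omega x (fun i => xi x (e i)) = 0
}.

Context (m : nat) (P : manifold R m) (pi : P -> M).

Definition vertical (p : P) : set 'rV[R]_m := [set v | dmap pi p v = 0].

Record shear_total_space (omega : vform 2 F)
    (theta : vform 1 (pullback_bundle pi F))
    (rho : forall p, 'Hom(F (pi p), 'rV[R]_m)) : Prop := ShearTotalSpace {
  total_dim : m = (n + r)%N;
  total_leaf_space : is_leaf_space vertical pi;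
  total_rho_smooth :
    @bundle_map_smooth R m P r m (pullback_bundle pi F) (tangent P) rho;
  total_theta_form : is_form theta;
  total_theta_rho : forall p f, theta p (fun _ => rho p f) = f;
  total_rho_vertical : forall p f, dmap pi p (rho p f) = 0;
  total_curvature : forall p X,
    ext_deriv (pullback_connection (q := pi) (nabla F)) theta p X =
    pullback_form pi omega p X
}.

Definition horizontal (theta : vform 1 (pullback_bundle pi F)) (p : P) :
    set 'rV[R]_m :=
  [set v | theta p (fun _ => v) = 0].

Definition horizontal_lift (theta : vform 1 (pullback_bundle pi F)) (p : P)
    (u : 'rV[R]_n) : 'rV[R]_m :=
  get [set v | horizontal theta p v /\ dmap pi p v = u].

Definition xi_ring (xi : forall x, 'Hom(E x, 'rV[R]_n))
    (a : forall x, 'Hom(E x, F x)) (theta : vform 1 (pullback_bundle pi F))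
    (rho : forall p, 'Hom(F (pi p), 'rV[R]_m)) (p : P) (e : E (pi p)) :
    'rV[R]_m :=
  horizontal_lift theta p (xi (pi p) e) + rho p (a (pi p) e).

Definition is_shear (xi : forall x, 'Hom(E x, 'rV[R]_n))
    (a : forall x, 'Hom(E x, F x)) (theta : vform 1 (pullback_bundle pi F))
    (rho : forall p, 'Hom(F (pi p), 'rV[R]_m)) (s : nat) (S : manifold R s)
    (piS : P -> S) : Prop :=
  is_leaf_space (fun p => range (xi_ring xi a theta rho (p := p))) piS.

Definition H_related (theta : vform 1 (pullback_bundle pi F)) (s : nat)
    (S : manifold R s) (piS : P -> S) (k : nat) (beta : rform M k)
    (betaS : rform S k) : Prop :=
  forall p (X : 'I_k -> 'rV[R]_m), (forall i, horizontal theta p (X i)) ->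
    pullback_form pi beta p X = pullback_form piS betaS p X.

End Shears.

(* Main.v *)
From HB Require Import structures.
From mathcomp Require Import all_boot all_order all_algebra all_fingroup.
From mathcomp Require Import all_classical all_reals all_analysis.
From mathcomp Require Import ring.
Require Import Defs.
Import Order.TTheory GRing.Theory Num.Theory numFieldNormedType.Exports.
Set Implicit Arguments.
Unset Strict Implicit.
Unset Printing Implicit Defensive.
Local Open Scope classical_set_scope.
Local Open Scope ring_scope.

(** Put [C = piS^* alphaS - pi^* alpha], a [k]-form on [P]. Since exterior
    derivatives commute with pull-backs ([ext_d_pullback]), the claim is that
    [dC] and the pull-back by [pi] of [- (xi a^-1 _| alpha) /\ omega] agree on
    horizontal vectors. Being [H]-related says exactly that [C] vanishes on
    horizontal vectors, so only the failure of the horizontal distribution to be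
    integrable can contribute to [dC] there, and that failure is measured by
    [d theta = pi^* omega].

    In detail, let [X_0, .., X_k] be horizontal at [p], extend them to constant
    fields in the chart at [p], and let [Y_j = X_j - rho (theta X_j)] be the
    horizontal parts of these fields. The value of [C] on any [k] of the [Y_j] is
    identically zero near [p]; its derivatives, expanded by the product rule,
    express [dC (X_0, .., X_k)] through [C] and the derivatives of the [Y_j]
    ([ext_d_vanishing]). By alternation only the antisymmetric combinations
    [D_{X_a} Y_b - D_{X_b} Y_a] matter ([altsum_antisym]), and these are
    [- rho (omega (X_a, X_b))] because [theta] vanishes on the [X_j] at [p] and
    [d theta = pi^* omega] ([curvature_horizontal]).

    It remains to evaluate [C] on a vertical vector [rho f] and horizontal ones.
    With [f = a e], the vector [rho f] differs from [xi_ring e], which [dpiS]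
    kills, by the horizontal lift of [xi e]; as [C] is known on horizontal
    vectors, this gives [C (rho f, ..) = - alpha (xi (a^-1 f), ..)]
    ([defect_rho]). The sum over pairs of positions then is the sum over
    permutations that defines the wedge product ([altsum_shuffle]). *)

(** * Alternating multilinear maps *)

Section AlternatingForms.
Context (R : realType) (n : nat).
Local Notation V := 'rV[R]_n.

Definition multilinear (k : nat) (B : ('I_k -> V) -> R^o) : Prop :=
  forall X i (c : R) (u v : V),
    B (upd X i (c *: u + v)) = c *: B (upd X i u) + B (upd X i v).

Definition alternating (k : nat) (B : ('I_k -> V) -> R^o) : Prop :=
  forall X i j, i != j -> X i = X j -> B X = 0.

Lemma upd_id k (X : 'I_k -> V) i : upd X i (X i) = X.
Proof. by apply/funext => j; rewrite /upd; case: eqP => [->|]. Qed.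

Lemma upd_same k (X : 'I_k -> V) i u : upd X i u i = u.
Proof. by rewrite /upd eqxx. Qed.

Lemma upd_comm k (X : 'I_k -> V) i j u v : i != j ->
  upd (upd X i u) j v = upd (upd X j v) i u.
Proof.
move=> ij; apply/funext => l; rewrite /upd.
by case: (l =P j) => [->|//]; rewrite eq_sym (negPf ij).
Qed.

Lemma vcons_upd k (X : 'I_k -> V) u v :
  upd (vcons u X) ord0 v = vcons v X.
Proof.
apply/funext => l; rewrite /upd /vcons.
by case: unliftP => [j ->|->]; rewrite ?eqxx // eq_sym (negPf (neq_lift _ _)).
Qed.

Lemma multilinear0 k (B : ('I_k -> V) -> R^o) X i :
  multilinear B -> B (upd X i 0) = 0.
Proof.
move=> mB; have /= := mB X i (-1) 0 0.
by rewrite scaler0 addr0 scaleN1r addNr.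
Qed.

Lemma multilinearD k (B : ('I_k -> V) -> R^o) X i u v : multilinear B ->
  B (upd X i (u + v)) = B (upd X i u) + B (upd X i v).
Proof. by move=> mB; rewrite -[u in LHS]scale1r mB scale1r. Qed.

Lemma multilinearZ k (B : ('I_k -> V) -> R^o) X i c u : multilinear B ->
  B (upd X i (c *: u)) = c *: B (upd X i u).
Proof. by move=> mB; rewrite -[c *: u]addr0 mB multilinear0// addr0. Qed.

Lemma multilinearN k (B : ('I_k -> V) -> R^o) X i u : multilinear B ->
  B (upd X i (- u)) = - B (upd X i u).
Proof. by move=> mB; rewrite -scaleN1r multilinearZ// scaleN1r. Qed.

Lemma multilinear_sum k (B : ('I_k -> V) -> R^o) X i (I : finType)
    (c : I -> R) (u : I -> V) : multilinear B ->
  B (upd X i (\sum_l c l *: u l)) = \sum_l c l *: B (upd X i (u l)).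
Proof.
move=> mB; elim/big_ind2: _ => [|x a y b <- <-|l _].
- by rewrite multilinear0.
- by rewrite multilinearD.
- by rewrite multilinearZ.
Qed.

Section Alternating.
Context (k : nat) (B : ('I_k -> V) -> R^o).
Hypotheses (mB : multilinear B) (aB : alternating B).

Lemma alternating_swap X i j : i != j -> B (X \o tperm i j) = - B X.
Proof.
move=> ij.
(* expand B on X with X i + X j in both positions *)
pose Z u v := upd (upd X i u) j v.
have ZX : Z (X i) (X j) = X by rewrite /Z upd_id upd_id.
have ZT : Z (X j) (X i) = X \o tperm i j.
  apply/funext => l; rewrite /Z /upd /=.
  case: (l =P j) => [->|lj]; first by rewrite tpermR.
  case: (l =P i) => [->|li]; first by rewrite tpermL.
  by rewrite tpermD //; apply/eqP => e; [case: li|case: lj].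
have Z0 u : B (Z u u) = 0.
  by apply: (aB ij); rewrite /Z /upd eqxx (negPf ij) eqxx.
have := Z0 (X i + X j).
rewrite /Z multilinearD // upd_comm // multilinearD //.
rewrite [in X in _ + X]upd_comm // multilinearD //.
rewrite -!(upd_comm _ _ _ ij) -!/(Z _ _) !Z0 add0r addr0.
by rewrite ZX ZT => /eqP; rewrite addr_eq0 => /eqP.
Qed.

Lemma alternating_perm X (s : 'S_k) : B (X \o s) = (-1) ^+ s * B X.
Proof.
case: (prod_tpermP s) => ts -> {s}.
elim: ts X => [|[i j] ts IH] X /=.
  move=> _; rewrite big_nil odd_perm1 mul1r; congr (B _).
  by apply/funext => l; rewrite /= perm1.
case/andP=> ij dts; rewrite big_cons odd_permM odd_tperm ij.
have -> : X \o (tperm i j * \prod_(t <- ts) tperm t.1 t.2)%g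
        = (X \o (\prod_(t <- ts) tperm t.1 t.2)%g) \o tperm i j.
  by apply/funext => l; rewrite /= permM.
by rewrite alternating_swap// IH// signr_addb expr1 mulN1r mulNr.
Qed.

End Alternating.

(** Moving an argument from position [j] to the front is a cycle of sign
    [(-1) ^ j]. *)
Lemma alternating_upd k (B : ('I_k.+1 -> V) -> R^o) X j u :
  multilinear B -> alternating B ->
  B (upd X j u) = (-1) ^+ j * B (vcons u (X \o lift j)).
Proof.
move=> mB aB; have -> : upd X j u = vcons u (X \o lift j) \o lift_perm j ord0 1.
  apply/funext => l; rewrite /upd /vcons /=.
  case: (unliftP j l) => [i ->|->].
    by rewrite lift_perm_lift liftK perm1 eq_sym (negPf (neq_lift _ _)).
  by rewrite lift_perm_id unlift_none eqxx.
by rewrite alternating_perm// odd_lift_perm odd_perm1 /= !addbF signr_odd.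
Qed.

(** What the formula for an exterior derivative of [B] produces from the
    variation of the arguments: [Q a b] stands for the derivative along [X a] of
    the argument whose value is [X b]. It occurs once for the second derivatives
    of a map along which a form is pulled back, and once for horizontal fields. *)
Definition altsum k (B : ('I_k -> V) -> R^o) (X : 'I_k.+1 -> V)
    (Q : 'I_k.+1 -> 'I_k.+1 -> V) : R :=
  \sum_(i < k.+1) (-1) ^+ i *
    \sum_(j < k) B (upd (X \o lift i) j (Q i (lift i j))).

Lemma altsumB k (B : ('I_k -> V) -> R^o) X Q1 Q2 : multilinear B ->
  altsum B X (fun a b => Q1 a b - Q2 a b) = altsum B X Q1 - altsum B X Q2.
Proof.
move=> mB; rewrite /altsum -sumrB; apply: eq_bigr => i _.
rewrite -mulrBr -sumrB; congr (_ * _); apply: eq_bigr => j _.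
by rewrite multilinearD// multilinearN.
Qed.

(** A permutation is determined by the image of the last point together with the
    permutation it induces between the complements; a count shows that this
    parametrization is onto. *)
Lemma sum_lift_perm (A : nmodType) l (f : 'S_l.+1 -> A) :
  \sum_s f s = \sum_i \sum_(t : 'S_l) f (lift_perm ord_max i t).
Proof.
pose h (it : 'I_l.+1 * 'S_l) := lift_perm ord_max it.1 it.2.
have hinj : injective h.
  move=> [i t] [j u] /permP e; have := e ord_max.
  rewrite !lift_perm_id /= => ij; rewrite -{}ij in e *; congr (_, _).
  apply/permP => a; apply: (@lift_inj _ i).
  by rewrite -!(lift_perm_lift ord_max i); exact: e.
rewrite pair_bigA; apply: (reindex h); apply: onW_bij; apply: inj_card_bij => //.
by rewrite card_prod !card_Sn card_ord factS.
Qed.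

Section Shuffle.
Context (j : nat) (B : ('I_j.+1 -> V) -> R^o) (X : 'I_j.+2 -> V).
Hypotheses (mB : multilinear B) (aB : alternating B).

Let pos1 : 'I_j.+2 := cast_ord (addn2 j) (rshift j (ord0 : 'I_2)).
Let pos2 : 'I_j.+2 := cast_ord (addn2 j) (rshift j (ord_max : 'I_2)).

(** The sum in the definition of the wedge product with a two-form, whose
    arguments sit in the last two positions. *)
Definition shuffle_sum (Q : 'I_j.+2 -> 'I_j.+2 -> V) : R :=
  \sum_(s : 'S_j.+2) (-1) ^+ s *
    B (vcons (Q (s pos1) (s pos2))
             (fun l => X (s (cast_ord (addn2 j) (lshift 2 l))))).

(** Exchanging the last two positions is an odd permutation. *)
Lemma shuffle_sum_tr Q : shuffle_sum (fun a b => Q b a) = - shuffle_sum Q.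
Proof.
rewrite /shuffle_sum (reindex_inj (mulgI (tperm pos1 pos2))) -sumrN.
have pos12 : pos1 != pos2 by rewrite -val_eqE /= eqn_add2l.
apply: eq_bigr => s _; rewrite odd_permM odd_tperm pos12 signr_addb expr1.
rewrite mulN1r mulNr !permM tpermL tpermR; congr (- (_ * B (vcons _ _))).
apply/funext => l; rewrite permM tpermD // -val_eqE /= ?addn0 gtn_eqF //.
exact: ltn_addr.
Qed.

(** Once the images of the last two positions are chosen, the [j!] ways of
    distributing the other vectors give equal terms, since [B] alternates. *)
Lemma shuffle_sum_altsum Q :
  shuffle_sum (fun a b => Q b a) = - (j`!%:R * altsum B X Q).
Proof.
rewrite /shuffle_sum sum_lift_perm /altsum mulr_sumr -sumrN.
apply: eq_bigr => i _.
rewrite sum_lift_perm !mulr_sumr -sumrN; apply: eq_bigr => l _.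
have p2 : pos2 = ord_max by apply: val_inj; rewrite /= addn1.
have p1 : pos1 = lift ord_max ord_max.
  by apply: val_inj; rewrite /= addn0 /bump leqNgt ltnS leqnn.
rewrite (eq_bigr (fun _ =>
  - ((-1) ^+ i * B (upd (X \o lift i) l (Q i (lift i l)))))); last first.
  move=> t _; rewrite p2 p1 lift_perm_lift !lift_perm_id.
  rewrite alternating_upd//.
  rewrite -[X in vcons _ X]/(fun l' => X _).
  have -> : vcons (Q i (lift i l)) (fun a => X (lift_perm ord_max i
       (lift_perm ord_max l t) (cast_ord (addn2 j) (lshift 2 a))))
     = vcons (Q i (lift i l)) ((X \o lift i) \o lift l) \o lift_perm ord0 ord0 t.
    apply/funext => a; rewrite /vcons /=.
    case: (unliftP ord0 a) => [b ->|->]; last by rewrite lift_perm_id unlift_none.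
    rewrite lift_perm_lift liftK.
    have -> : cast_ord (addn2 j) (lshift 2 b) = lift ord_max (lift ord_max b).
      apply: val_inj; rewrite /= /bump.
      by rewrite (leqNgt j) ltn_ord add0n leqNgt ltnW ?ltnS ?ltn_ord.
    by rewrite !lift_perm_lift.
  rewrite alternating_perm// !odd_lift_perm /= !mulrA.
  rewrite -!signr_addb -mulNr; congr (_ * _).
  rewrite -(signr_odd _ i) -(signr_odd _ l) -signr_addb -signrN.
  congr (_ ^+ nat_of_bool _).
  by case: (odd i); case: (odd l); case: (odd j); case: (odd_perm t).
by rewrite sumr_const card_Sn -[LHS]mulr_natl mulrN.
Qed.

End Shuffle.

Lemma altsum_tr k (B : ('I_k -> V) -> R^o) X Q :
  multilinear B -> alternating B ->
  altsum B X (fun a b => Q b a) = - altsum B X Q.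
Proof.
case: k B X Q => [|j] B X Q mB aB.
  suff E Q' : altsum B X Q' = 0 by rewrite !E oppr0.
  by rewrite /altsum big1// => i _; rewrite big_ord0 mulr0.
have j0 : (j`!%:R : R) != 0 by rewrite pnatr_eq0 -lt0n fact_gt0.
apply: (mulfI j0); rewrite mulrN -shuffle_sum_altsum//.
by rewrite -[LHS]opprK -shuffle_sum_altsum// shuffle_sum_tr opprK.
Qed.

(** Only the antisymmetric part of [Q] counts: symmetric second derivatives
    disappear, and horizontal fields enter through their brackets. *)
Lemma altsum_antisym k (B : ('I_k -> V) -> R^o) X Q :
  multilinear B -> alternating B ->
  altsum B X Q = 2^-1 * altsum B X (fun a b => Q a b - Q b a).
Proof.
move=> mB aB; rewrite altsumB// [X in _ - X]altsum_tr// opprK.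
by rewrite -mulr2n -[X in _ * X]mulr_natl mulrA mulVf ?mul1r// pnatr_eq0.
Qed.

Lemma altsum_shuffle j (B : ('I_j.+1 -> V) -> R^o) X Q :
  multilinear B -> alternating B ->
  altsum B X Q = j`!%:R^-1 * shuffle_sum B X Q.
Proof.
move=> mB aB; rewrite -[shuffle_sum _ _ _]opprK -shuffle_sum_tr.
by rewrite shuffle_sum_altsum// opprK mulKf.
Qed.

End AlternatingForms.

(** * Product rule and symmetry of second derivatives *)

Section Calculus.
Context (R : realType).

Lemma derive_coord (U : normedModType R) n (f : U -> 'rV[R]_n) z u l :
  derivable f z u -> 'D_u (fun y => f y ord0 l : R) z = ('D_u f z) ord0 l.
Proof. by move=> df; rewrite derive_mx// mxE. Qed.

Lemma row_basis n (v : 'rV[R]_n) : v = \sum_l v ord0 l *: delta_mx ord0 l.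
Proof. exact: row_sum_delta. Qed.

Section Leibniz.
Context (U : normedModType R) (n k : nat) (B : U -> ('I_k -> 'rV[R]_n) -> R^o).
Context (z u : U).
Hypotheses (mB : forall y, multilinear (B y))
  (dB : forall v, derivable (B ^~ v) z u).

Lemma derive_multilinear : multilinear (fun v => 'D_u (B ^~ v) z : R^o).
Proof.
move=> X i c v w; have -> : B ^~ (upd X i (c *: v + w)) =
    c *: (B ^~ (upd X i v)) + B ^~ (upd X i w).
  by apply/funext => y; rewrite mB.
by rewrite deriveD ?deriveZ//; exact: derivableZ.
Qed.

(** By induction on the number [t] of arguments that are allowed to vary: the
    last of these is expanded in the standard basis, which leaves the product
    of a coordinate function with an expression where one argument fewer varies. *)
Lemma is_derive_multilinear (Y : 'I_k -> U -> 'rV[R]_n) :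
  (forall j, derivable (Y j) z u) ->
  is_derive z u (fun y => B y (Y ^~ y))
    ('D_u (B ^~ (Y ^~ z)) z + \sum_j B z (upd (Y ^~ z) j ('D_u (Y j) z))).
Proof.
suff main t (Z : 'I_k -> U -> 'rV[R]_n) :
    (forall j : 'I_k, (t <= j)%N -> Z j = cst (Z j z)) ->
    (forall j, derivable (Z j) z u) ->
    is_derive z u (fun y => B y (Z ^~ y))
    ('D_u (B ^~ (Z ^~ z)) z + \sum_j B z (upd (Z ^~ z) j ('D_u (Z j) z))).
  by move=> dY; apply: (main k) => // j; rewrite leqNgt ltn_ord.
elim: t Z => [|t IH] Z cZ dZ.
  rewrite big1 ?addr0.
    suff -> : (fun y => B y (Z ^~ y)) = B ^~ (Z ^~ z) by exact: derivableP.
    apply/funext => y; congr (B y _); apply/funext => j; by rewrite cZ.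
  by move=> j _; rewrite cZ// derive_cst multilinear0.
have [tk|kt] := ltnP t k; last first.
  by apply: IH => // j tj; have := leq_trans kt tj; rewrite leqNgt ltn_ord.
pose i := Ordinal tk.
pose e l : 'rV[R]_n := delta_mx ord0 l.
pose Zl l j y := upd (Z ^~ y) i (e l) j.
have Zli l : Zl l i = cst (e l) by apply/funext => y; rewrite /Zl upd_same.
have Zlj l j : j != i -> Zl l j = Z j.
  by move=> ji; apply/funext => y; rewrite /Zl /upd (negPf ji).
have dl l : is_derive z u (fun y => B y (Zl l ^~ y))
    ('D_u (B ^~ (Zl l ^~ z)) z + \sum_j B z (upd (Zl l ^~ z) j ('D_u (Zl l j) z))).
  apply: IH => j; have [->|ji] := eqVneq j i; rewrite ?Zli ?Zlj//.
  by move=> tj; apply: cZ; rewrite ltn_neqAle tj andbT eq_sym; exact: ji.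
have dc l : is_derive z u (fun y => Z i y ord0 l : R) (('D_u (Z i) z) ord0 l).
  rewrite -derive_coord//; apply: derivableP.
  by have /derivable_mxP := dZ i; exact.
have E : (fun y => B y (Z ^~ y)) =
    \sum_l ((fun y => Z i y ord0 l : R) * (fun y => B y (Zl l ^~ y) : R)).
  apply/funext => y; rewrite fct_sumE /= -[in LHS](upd_id (Z ^~ y) i).
  by rewrite [X in upd _ _ X]row_basis multilinear_sum.
rewrite {}E; have dS := is_derive_sum (fun l => is_deriveM (dc l) (dl l)).
apply: (is_derive_eq dS).
rewrite big_split /=.
under eq_bigr => l _ do rewrite scalerDr.
rewrite big_split /= -addrA; congr (_ + _).
  have <- := multilinear_sum (Z ^~ z) i _ _ derive_multilinear.
  by rewrite -row_basis upd_id.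
rewrite [RHS](bigD1 i)//= [LHS]addrC; congr (_ + _).
  rewrite [X in upd _ _ X]row_basis multilinear_sum//.
  by apply: eq_bigr => l _; rewrite [LHS]mulrC.
under eq_bigr => l _ do rewrite scaler_sumr.
rewrite exchange_big /= (bigD1 i)//= big1 ?add0r; last first.
  by move=> l _; rewrite Zli derive_cst multilinear0// scaler0.
apply: eq_bigr => j ji.
under eq_bigr => l _ do
  rewrite Zlj// -[Zl l ^~ z]/(upd (Z ^~ z) i (e l)) upd_comm 1?eq_sym//.
rewrite -multilinear_sum// -row_basis -upd_comm 1?eq_sym//.
by rewrite [upd (Z ^~ z) i _]upd_id.
Qed.

End Leibniz.

Section Symmetry.
Context (V : normedModType R).
Implicit Types (f : V -> R) (z u v : V).

Lemma midpoint_far (a b w : R) :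
  `|a - w| < `|a - b| / 2 -> `|b - w| < `|a - b| / 2 -> False.
Proof.
rewrite (distrC b) => A B; have := le_lt_trans (ler_distD w a b) (ltrD A B).
by rewrite -splitr ltxx.
Qed.

Lemma second_difference_eq (h a b c d x y : R) : 0 < h ->
  a - b - (c - d) = h * (h * x) -> a - c - (b - d) = h * (h * y) -> x = y.
Proof.
move=> h0 E1 E2; have hn : h != 0 by rewrite gt_eqF.
by apply: (mulfI hn); apply: (mulfI hn); rewrite -E1 -E2; ring.
Qed.

Lemma is_derive_along f w d (t : R) : derivable f (t *: d + w) d ->
  is_derive t 1 (fun s => f (s *: d + w)) ('D_d f (t *: d + w)).
Proof.
move=> df; have E : (fun h : R => h^-1 *: (f ((h *: 1 + t) *: d + w) - f (t *: d + w)))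
    = (fun h : R => h^-1 *: (f (h *: d + (t *: d + w)) - f (t *: d + w))).
  by apply/funext => h; rewrite [h *: 1]mulr1 scalerDl addrA.
split; last by rewrite /derive /= E.
by move: df; rewrite /derivable /= E.
Qed.

Lemma mean_value_along f w d (h : R) : 0 < h ->
  (forall t, 0 <= t <= h -> derivable f (t *: d + w) d) ->
  exists2 c, 0 <= c <= h & f (h *: d + w) - f w = h * 'D_d f (c *: d + w).
Proof.
move=> h0 df.
have [||c ch E] := @MVT R (fun s => f (s *: d + w)) (fun s => 'D_d f (s *: d + w)) 0 h h0.
- move=> t; rewrite in_itv /= => /andP[t0 th].
  by apply: is_derive_along; apply: df; rewrite !ltW.
- apply: derivable_within_continuous => t; rewrite in_itv /= => th.
  by have [] := is_derive_along (df _ th).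
move: ch; rewrite in_itv /= => /andP[c0 ch]; exists c; first by rewrite !ltW.
by move: E; rewrite scale0r add0r subr0 mulrC.
Qed.

(** The mean value theorem, applied first along [u] to the increment of [f] in the
    direction [v], and then along [v] to ['D_u f]. *)
Lemma second_difference f z u v (h : R) : 0 < h ->
  (forall s t, 0 <= s <= h -> 0 <= t <= h ->
    derivable f (s *: u + (t *: v + z)) u /\
    derivable ('D_u f) (s *: u + (t *: v + z)) v) ->
  exists c d, [/\ 0 <= c <= h, 0 <= d <= h &
    f (h *: u + (h *: v + z)) - f (h *: v + z) - (f (h *: u + z) - f z) =
    h * (h * 'D_v ('D_u f) (c *: u + (d *: v + z)))].
Proof.
move=> h0 df; have hh : 0 <= h <= h by rewrite lexx ltW.
have oh : 0 <= (0 : R) <= h by rewrite lexx ltW.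
pose g (y : V) : R := f (h *: v + y) - f y.
have dshift y : derivable f (h *: v + y) u -> is_derive y u (fun y => f (h *: v + y)) ('D_u f (h *: v + y)).
  move=> dy; have E : (fun t : R => t^-1 *: (f (h *: v + (t *: u + y)) - f (h *: v + y)))
      = (fun t : R => t^-1 *: (f (t *: u + (h *: v + y)) - f (h *: v + y))).
    by apply/funext => t; rewrite addrCA.
  split; last by rewrite /derive /= E.
  by move: dy; rewrite /derivable /= E.
have dg s : 0 <= s <= h -> is_derive (s *: u + z) u g
    ('D_u f (h *: v + (s *: u + z)) - 'D_u f (s *: u + z)).
  move=> sh; apply: is_deriveB.
    by apply: dshift; rewrite addrCA; exact: (df s h sh hh).1.
  by apply: derivableP; have := (df s 0 sh oh).1; rewrite scale0r add0r.
have [|c ch E] := @mean_value_along g z u h h0.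
  by move=> s sh; have [] := dg _ sh.
have [t th|d dh E'] := @mean_value_along ('D_u f) (c *: u + z) v h h0.
  by rewrite addrCA; exact: (df c t ch th).2.
exists c, d; split => //.
have [_ Dg] := dg _ ch; rewrite Dg in E.
rewrite (addrCA (c *: u)) -E' -E /g (addrCA (h *: v)).
by rewrite !opprB addrACA [RHS]addrACA; congr (_ + _); rewrite addrC.
Qed.

(** Both mixed derivatives take, at points arbitrarily close to [z], the value of
    the same second difference quotient, so by continuity they agree at [z]. *)
Lemma symmetric_second_derivative f z u v :
  (\forall y \near z, [/\ derivable f y u, derivable f y v,
     derivable ('D_u f) y v & derivable ('D_v f) y u]) ->
  {for z, continuous ('D_v ('D_u f))} -> {for z, continuous ('D_u ('D_v f))} ->
  'D_v ('D_u f) z = 'D_u ('D_v f) z.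
Proof.
move=> df cvu cuv; apply/eqP; rewrite -subr_eq0 -normr_eq0; apply/negPn/negP => nz.
set a := 'D_v _ z in nz *; set b := 'D_u _ z in nz *.
have e0 : 0 < `|a - b| / 2 by rewrite divr_gt0// lt_neqAle eq_sym nz normr_ge0.
have ca : \forall y \near z, `|a - 'D_v ('D_u f) y| < `|a - b| / 2.
  by have /cvgrPdist_lt /(_ _ e0) := cvu.
have cb : \forall y \near z, `|b - 'D_u ('D_v f) y| < `|a - b| / 2.
  by have /cvgrPdist_lt /(_ _ e0) := cuv.
have /nbhs_ballP[r1 /= r10 dP] := df.
have /nbhs_ballP[r2 /= r20 aP] := ca.
have /nbhs_ballP[r3 /= r30 bP] := cb.
pose r := Num.min r1 (Num.min r2 r3).
have r0 : 0 < r by rewrite !lt_min r10 r20.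
have rP y : ball z r y -> [/\ derivable f y u, derivable f y v,
     derivable ('D_u f) y v & derivable ('D_v f) y u] /\
     (`|a - 'D_v ('D_u f) y| < `|a - b| / 2 /\ `|b - 'D_u ('D_v f) y| < `|a - b| / 2).
  move=> zy; split; last split.
  - by apply: dP; apply: le_ball zy; rewrite !ge_min lexx.
  - by apply: aP; apply: le_ball zy; rewrite !ge_min lexx !orbT.
  - by apply: bP; apply: le_ball zy; rewrite !ge_min lexx !orbT.
pose h := r / (`|u| + `|v| + 1).
have n0 : 0 < `|u| + `|v| + 1 by rewrite ltr_wpDl// addr_ge0.
have h0 : 0 < h by rewrite divr_gt0.
have inr s t : 0 <= s <= h -> 0 <= t <= h -> ball z r (s *: u + (t *: v + z)).
  move=> /andP[s0 sh] /andP[t0 th]; rewrite -ball_normE /ball_ /=.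
  rewrite addrA opprD addrCA subrr addr0 normrN.
  apply: (le_lt_trans (ler_normD _ _)); rewrite !normrZ !ger0_norm//.
  apply: (@le_lt_trans _ _ (h * `|u| + h * `|v|)).
    by apply: lerD; apply: ler_wpM2r.
  have -> : r = h * (`|u| + `|v| + 1) by rewrite divfK ?gt_eqF.
  by rewrite -mulrDr ltr_pM2l// ltrDl.
have dPr s t (sh : 0 <= s <= h) (th : 0 <= t <= h) := (rP _ (inr s t sh th)).1.
have duv s t : 0 <= s <= h -> 0 <= t <= h ->
    derivable f (s *: u + (t *: v + z)) u /\
    derivable ('D_u f) (s *: u + (t *: v + z)) v.
  by move=> sh th; case: (dPr s t sh th) => d1 _ d2 _; split; [exact: d1|exact: d2].
have dvu s t : 0 <= s <= h -> 0 <= t <= h ->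
    derivable f (s *: v + (t *: u + z)) v /\
    derivable ('D_v f) (s *: v + (t *: u + z)) u.
  rewrite (addrCA (s *: v)) => sh th.
  by case: (dPr t s th sh) => _ d1 _ d2; split; [exact: d1|exact: d2].
have [c [d [ch dh E]]] := second_difference h0 duv.
have [c' [d' [ch' dh' E']]] := second_difference h0 dvu.
rewrite (addrCA (h *: v)) (addrCA (c' *: v)) in E'.
have EE := second_difference_eq h0 E E'.
have [_ [A _]] := rP _ (inr _ _ ch dh).
have [_ [_ B]] := rP _ (inr _ _ dh' ch').
rewrite EE in A; exact: (midpoint_far A B).
Qed.

End Symmetry.

End Calculus.

(** * Smooth functions *)

Section SmoothFunctions.
Context (R : realType).
Implicit Types V W : normedModType R.

(** The expansion of [f] at [z] is one of [g] as well, since it only concerns a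
    neighbourhood of [z]. *)
Lemma near_eq_differentiable V W (f g : V -> W) z :
  (\forall y \near z, f y = g y) -> differentiable f z -> differentiable g z.
Proof.
move=> fg df.
have fgz : f z = g z := nbhs_singleton fg.
have gE : g \o shift z = cst (g z) + 'd f z +o_ 0 id.
  apply/eqaddoP => _/posnumP[e].
  have /eqaddoP /(_ e%:num) /(_ [gt0 of e%:num]) := diff_locally df.
  have fgs : \forall h \near 0, f (h + z) = g (h + z).
    by have := fg; rewrite (near_shift 0) /=; apply: filterS => h; rewrite /= subr0.
  apply: filter_app; near=> h => /=.
  rewrite -![(_ + _ : _ -> _) _]/(_ + _) -![(- _ : _ -> _) _]/(- _) /cst /=.
  by rewrite -fgz -(near fgs h).
have dgf : 'd g z = 'd f z :> (V -> W).
  by apply: diff_unique => //; exact: diff_continuous.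
by apply/diff_locallyP; rewrite dgf; split=> //; exact: diff_continuous.
Unshelve. all: by end_near. Qed.

Lemma Ck_on_eq V W k (U : set V) (f g : V -> W) : open U ->
  (forall z, U z -> f z = g z) -> Ck_on k U f -> Ck_on k U g.
Proof.
move=> oU; elim: k f g => [|k IH] f g fg.
  move=> /= cf z Uz; have fgz := open_nbhs_nbhs (conj oU Uz).
  suff : g @ z --> g z by [].
  rewrite -(fg _ Uz); apply: cvg_trans (cf z Uz).
  by apply: near_eq_cvg; apply: filterS fgz => y; exact: fg.
move=> [df Df]; have nfg z : U z -> \forall y \near z, f y = g y.
  by move=> Uz; apply: filterS (open_nbhs_nbhs (conj oU Uz)) => y /fg.
split=> [z Uz|v].
  by apply: near_eq_differentiable (nfg z Uz) _; exact: df.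
apply: IH (Df v) => z Uz; apply: near_eq_derive; exact: nfg.
Qed.

Lemma Ck_on_cst V W k (U : set V) (a : W) : Ck_on k U (cst a : V -> W).
Proof.
elim: k a => [|k IH] a /=; first by move=> z _; exact: cst_continuous.
split=> [z _|v]; first exact: differentiable_cst.
suff -> : 'D_v (cst a : V -> W) = cst 0 by exact: IH.
by apply/funext => z; rewrite derive_cst.
Qed.

Lemma smooth_near_locally_cst V W (f : V -> W) z a :
  (\forall y \near z, f y = a) -> smooth_near f z.
Proof.
rewrite /= => fa.
exists (interior [set y | f y = a]).
  by split; [exact: open_interior|exact: fa].
move=> k; apply: (@Ck_on_eq _ _ _ _ (cst a)); first exact: open_interior.
  by move=> y /interior_subset /= ->.
exact: Ck_on_cst.
Qed.

Lemma smooth_near_differentiable V W (f : V -> W) z : smooth_near f z ->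
  \forall y \near z, differentiable f y.
Proof.
move=> [U [oU Uz] sf]; apply: filterS (open_nbhs_nbhs (conj oU Uz)) => y Uy.
exact: (sf 1%N).1.
Qed.

Lemma smooth_near_derive V W (f : V -> W) z v : smooth_near f z ->
  smooth_near ('D_v f) z.
Proof. by move=> [U oU sf]; exists U => // k; have [_] := sf k.+1; exact. Qed.

Lemma linear_derive V W (f : V -> W) z c u v : differentiable f z ->
  'D_(c *: u + v) f z = c *: 'D_u f z + 'D_v f z.
Proof. by move=> df; rewrite !deriveE// linearP. Qed.

Lemma derive_comp V W (X : normedModType R) (f : V -> W) (g : W -> X) z v :
  differentiable f z -> differentiable g (f z) ->
  'D_v (g \o f) z = 'D_('D_v f z) g (f z).
Proof.
move=> df dg; have dgf := differentiable_comp df dg.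
by rewrite !deriveE// diff_comp.
Qed.

(** Coordinatewise reduction to the scalar case. *)
Lemma symmetric_smooth_derivative V n (g : V -> 'rV[R]_n) z u v :
  smooth_near g z -> 'D_u ('D_v g) z = 'D_v ('D_u g) z.
Proof.
move=> [U [oU Uz] sg].
have d1 y : U y -> differentiable g y by exact: (sg 1%N).1.
have d2 w y : U y -> differentiable ('D_w g) y.
  by have [_ /(_ w) []] := sg 2%N => + _; exact.
have c2 w w' y : U y -> {for y, continuous ('D_w ('D_w' g))}.
  have [_ /(_ w') [_ /(_ w)]] := sg 2%N; exact.
have nU y : U y -> nbhs y U by move=> Uy; exact: open_nbhs_nbhs.
apply/rowP => l; pose f y := g y ord0 l : R.
have D1 w y : U y -> 'D_w f y = 'D_w g y ord0 l.
  by move=> Uy; apply: derive_coord; apply: diff_derivable; exact: d1.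
have nD1 w y : U y -> \forall y' \near y, 'D_w g y' ord0 l = 'D_w f y'.
  by move=> /nU; apply: filterS => y' /D1 ->.
have D2 w w' y : U y -> 'D_w' ('D_w f) y = 'D_w' ('D_w g) y ord0 l.
  move=> Uy; rewrite -derive_coord; last exact/diff_derivable/d2.
  by apply: near_eq_derive; apply: filterS (nD1 w y Uy).
have dc (h : V -> 'rV[R]_n) w y : differentiable h y ->
    derivable (fun y' => h y' ord0 l : R) y w.
  by move=> /diff_derivable dh; have /derivable_mxP := dh w; exact.
have dd w w' y : U y -> derivable ('D_w f) y w'.
  by move=> Uy; apply: near_eq_derivable (nD1 w y Uy) _; apply/dc/d2.
have cc w w' : {for z, continuous ('D_w' ('D_w f))}.
  suff : 'D_w' ('D_w f) @ z --> 'D_w' ('D_w f) z by [].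
  rewrite D2//.
  apply: (@cvg_trans _ ((fun y => 'D_w' ('D_w g) y ord0 l) @ z)).
    by apply: near_eq_cvg; apply: filterS (nU z Uz) => y /D2 ->.
  apply: (@continuous_comp _ _ _ ('D_w' ('D_w g)) (fun M : 'rV[R]_n => M ord0 l)).
    exact: c2.
  exact: coord_continuous.
apply: etrans (esym (D2 v u z Uz)) _; apply: etrans (D2 u v z Uz).
apply: symmetric_second_derivative; [|exact: cc|exact: cc].
apply: filterS (nU z Uz) => y Uy.
by split; [exact/dc/d1|exact/dc/d1|exact: dd|exact: dd].
Qed.

End SmoothFunctions.

(** * Charts and tangent vectors *)

Section Charts.
Context (R : realType) (n : nat) (N : manifold R n).
Implicit Types (x y : N) (v : 'rV[R]_n).

Lemma near_dom x y : dom x y -> \forall y' \near y, dom x y'.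
Proof. by move=> xy; apply: open_nbhs_nbhs; split=> //; exact: dom_open. Qed.

Lemma near_psi (Q : N -> Prop) x y : dom x y ->
  (\forall y' \near y, Q y') -> \forall w \near phi x y, Q (psi x w).
Proof.
move=> xy QE; have : {for phi x y, continuous (psi x)}.
  by apply: psi_continuous; exists y.
by move=> c; have := c Q; rewrite /= phiK//; apply.
Qed.

Lemma near_psiK x y : dom x y ->
  \forall w \near phi x y, dom x (psi x w) /\ phi x (psi x w) = w.
Proof.
move=> xy; have o : open_nbhs (phi x y) (phi x @` dom x).
  by split; [exact: phi_dom_open|exists y].
by apply: filterS (open_nbhs_nbhs o) => _ [y' xy' <-]; rewrite phiK.
Qed.

Lemma transition_differentiable x y y' : dom x y' -> dom y y' ->
  differentiable (phi x \o psi y) (phi y y').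
Proof.
move=> xy yy; have [d _] := chart_compat y x 1.
by apply: d; exists y'.
Qed.

Lemma tangent_trivE x y v : dom x y ->
  triv (tangent N) x y v = 'D_v (phi x \o psi y) (phi y y).
Proof.
move=> xy; have d := transition_differentiable xy (dom_self y).
rewrite /= (_ : (fun u => _) = 'd (phi x \o psi y) (phi y y)) ?lfunE ?deriveE//.
by apply/funext => u; rewrite /mderiv deriveE.
Qed.

(** Change of charts: the chain rule for the transition map. *)
Lemma mderiv_chart (W : normedModType R) (f : N -> W) x y v : dom x y ->
  differentiable (f \o psi x) (phi x y) ->
  mderiv f y v = 'D_(triv (tangent N) x y v) (f \o psi x) (phi x y).
Proof.
move=> xy df; have d := transition_differentiable xy (dom_self y).
have e : phi x y = (phi x \o psi y) (phi y y) by rewrite /= phiK//; exact: dom_self.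
rewrite /mderiv tangent_trivE// [in RHS]e -derive_comp -?e//.
apply: near_eq_derive.
apply: filterS (near_psi (dom_self y) (near_dom xy)) => w xw /=.
by rewrite phiK.
Qed.

Lemma tangent_triv_id x v : triv (tangent N) x x v = v.
Proof.
have xx := dom_self x.
rewrite tangent_trivE// -[RHS](derive_id (phi x x)); apply: near_eq_derive.
by apply: filterS (near_psiK xx) => w [].
Qed.

(** A transition map has the opposite transition map as a local inverse, and the
    chain rule turns this into injectivity of its differential. *)
Lemma tangent_triv_lker0 x y : dom x y -> lker (triv (tangent N) x y) == 0%VS.
Proof.
move=> xy; rewrite -subv0; apply/subvP => v.
rewrite memv_ker memv0 => /eqP v0; apply/eqP.
rewrite -[v](tangent_triv_id y) tangent_trivE; last exact: dom_self.
rewrite -[LHS]/(mderiv (phi y) y v) (mderiv_chart v xy).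
  by rewrite v0 derive0.
by apply: transition_differentiable => //; exact: dom_self.
Qed.

Lemma tangent_trivK x y v : dom x y ->
  ((triv (tangent N) x y)^-1)%VF (triv (tangent N) x y v) = v.
Proof. by move=> xy; rewrite lker0_lfunK//; exact: tangent_triv_lker0. Qed.

Lemma tangent_trivVK x y v : dom x y ->
  triv (tangent N) x y (((triv (tangent N) x y)^-1)%VF v) = v.
Proof.
by move=> xy; apply: (@lker0_lfunVK _ 'rV[R]_n); exact: tangent_triv_lker0.
Qed.

Lemma const_ext_tangent x y v :
  const_ext (v : tangent N x) y = ((triv (tangent N) x y)^-1)%VF v.
Proof. by rewrite /const_ext tangent_triv_id. Qed.

Lemma msmooth_near_locally_cst (W : normedModType R) (f : N -> W) x a :
  (\forall y \near x, f y = a) -> msmooth_near f x.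
Proof.
move=> fa; apply: (@smooth_near_locally_cst _ _ _ _ _ a).
exact: near_psi (dom_self x) fa.
Qed.

Lemma const_ext_smooth r (B : bundle_data N r) x (e : B x) :
  (\forall y \near x, limg (triv B x y) = fullv) ->
  section_smooth_near (const_ext e) x.
Proof.
move=> sB; apply: (@msmooth_near_locally_cst _ _ _ (triv B x x e)).
by apply: filterS sB => y sy; rewrite limg_lfunVK// sy memvf.
Qed.

Lemma const_ext_tangent_smooth x v :
  section_smooth_near (const_ext (v : tangent N x)) x.
Proof.
apply: const_ext_smooth; apply: filterS (near_dom (dom_self x)) => y xy.
by apply: lker0_limgf; exact: tangent_triv_lker0.
Qed.

End Charts.

(** * Forms in charts, and naturality of the exterior derivative *)

(** For functions that carry no bundled linear structure. *)
Lemma linfunE (K : nzRingType) (aT rT : vectType K) (f : aT -> rT) :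
  linear f -> linfun f =1 f.
Proof.
move=> lf; pose g : {linear aT -> rT} := HB.pack f (GRing.isLinear.Build _ _ _ _ f lf).
exact: (lfunE g).
Qed.

Section LocalForms.
Context (R : realType) (n : nat) (N : manifold R n).

(** The coordinate expression of a form in the chart at [x]. *)
Definition local_form k (beta : rform N k) (x : N) (w : 'rV[R]_n)
    (v : 'I_k -> 'rV[R]_n) : R^o :=
  beta (psi x w) (fun j => ((triv (tangent N) x (psi x w))^-1)%VF (v j)).

Definition multilinear_form k (beta : rform N k) : Prop :=
  forall x, multilinear (beta x : ('I_k -> 'rV[R]_n) -> R^o).

Definition alternating_form k (beta : rform N k) : Prop :=
  forall x, alternating (beta x : ('I_k -> 'rV[R]_n) -> R^o).

(** Weaker than smoothness; this is all that the product rule needs, and it can be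
    read off for a pull-back without showing that the pull-back is smooth. *)
Definition derivable_form k (beta : rform N k) (x : N) : Prop :=
  forall v u, derivable (local_form beta x ^~ v) (phi x x) u.

Lemma is_form_multilinear k (beta : rform N k) :
  is_form beta -> multilinear_form beta.
Proof. by move=> [lb _ _] x X i c u v; exact: lb. Qed.

Lemma is_form_alternating k (beta : rform N k) :
  is_form beta -> alternating_form beta.
Proof. by move=> [_ ab _] x X i j; exact: ab. Qed.

Lemma map_upd m k (L : 'rV[R]_m -> 'rV[R]_n) (X : 'I_k -> 'rV[R]_m) i u :
  (fun j => L (upd X i u j)) = upd (fun j => L (X j)) i (L u).
Proof. by apply/funext => j; rewrite /upd; case: eqP. Qed.

Lemma multilinear_comp m k (B : ('I_k -> 'rV[R]_n) -> R^o)
    (L : 'rV[R]_m -> 'rV[R]_n) :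
  (forall c u v, L (c *: u + v) = c *: L u + L v) -> multilinear B ->
  multilinear (fun v : 'I_k -> 'rV[R]_m => B (fun j => L (v j))).
Proof. by move=> lL mB X i c u v; rewrite !map_upd lL mB. Qed.

Lemma local_form_multilinear k (beta : rform N k) x w :
  multilinear_form beta -> multilinear (local_form beta x w).
Proof. by move=> mb; apply: multilinear_comp => [c u v|//]; exact: linearP. Qed.

Lemma local_form_center k (beta : rform N k) x v :
  local_form beta x (phi x x) v = beta x v.
Proof.
have xx := dom_self x; rewrite /local_form phiK//; congr (beta x _).
by apply/funext => j; rewrite -[RHS](tangent_trivK _ xx) tangent_triv_id.
Qed.

Lemma ext_d_local k (beta : rform N k) x X :
  ext_d beta x X = \sum_(i < k.+1) (-1) ^+ i *
    'D_(X i) (local_form beta x ^~ (X \o lift i)) (phi x x) :> R.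
Proof.
apply: eq_bigr => i _.
have -> : local_form beta x ^~ (X \o lift i) = (fun y : N => beta y
    (fun j => const_ext (X (lift i j) : tangent N x) y)) \o psi x.
  apply/funext => w; rewrite /local_form /=; congr (beta _ _).
  by apply/funext => j; rewrite const_ext_tangent.
by [].
Qed.

Lemma is_form_differentiable k (beta : rform N k) x v : is_form beta ->
  differentiable (local_form beta x ^~ v) (phi x x).
Proof.
move=> [_ _ sb].
have sv j : section_smooth_near (const_ext (v j : tangent N x)) x.
  exact: const_ext_tangent_smooth.
have /smooth_near_differentiable/nbhs_singleton d := sb x _ sv.
set f := (X in differentiable X _) in d.
have -> : local_form beta x ^~ v = (fun M : 'rV[R]_1 => M ord0 ord0 : R^o) \o f.
  apply/funext => w; rewrite /f /= linfunE; last by move=> c a b; apply/rowP => l; rewrite !mxE.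
  rewrite mxE /local_form; congr (beta _ _).
  by apply/funext => j; rewrite const_ext_tangent.
apply: differentiable_comp => //; exact: differentiable_coord.
Qed.

(** The product rule for the identity [beta (Y_1, .., Y_k) = 0]: the derivatives of
    the coefficients of [beta], which make up [ext_d beta], are opposite to the
    contribution of the derivatives of the fields. *)
Lemma ext_d_vanishing k (beta : rform N k) x X
    (Y : 'I_k.+1 -> 'rV[R]_n -> 'rV[R]_n) :
  multilinear_form beta -> derivable_form beta x ->
  (forall j u, derivable (Y j) (phi x x) u) ->
  (forall j, Y j (phi x x) = X j) ->
  (forall i : 'I_k.+1, \forall w \near phi x x,
     local_form beta x w (fun j => Y (lift i j) w) = 0) ->
  ext_d beta x X = - altsum (beta x : _ -> R^o) X
    (fun a b => 'D_(X a) (Y b) (phi x x)).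
Proof.
move=> mb db dY YX b0; rewrite ext_d_local /altsum -sumrN; apply: eq_bigr => i _.
rewrite -mulrN; congr (_ * _).
have [_ E] := is_derive_multilinear (fun w => local_form_multilinear x w mb)
  (fun v => db v (X i)) (fun j => dY (lift i j) (X i)).
have Y0 : 'D_(X i) (fun w => local_form beta x w (fun j => Y (lift i j) w))
    (phi x x) = 0.
  by rewrite -[RHS](derive_cst (0 : R^o) (phi x x) (X i));
    apply: near_eq_derive; exact: b0.
have XE : (fun j => Y (lift i j) (phi x x)) = X \o lift i.
  by apply/funext => j; rewrite YX.
move: E; rewrite Y0 XE => /esym/eqP; rewrite addr_eq0 => /eqP ->.
by congr (- _); apply: eq_bigr => j _; rewrite local_form_center.
Qed.

End LocalForms.

Section Pullback.
Context (R : realType) (m n : nat) (P : manifold R m) (N : manifold R n).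
Context (q : P -> N) (smooth_q : smooth_map q).

Lemma near_map (Q : N -> Prop) p : (\forall y \near q p, Q y) ->
  \forall p' \near p, Q (q p').
Proof. by move=> QE; have [cq _] := smooth_q; exact: cq. Qed.

Lemma map_differentiable p :
  differentiable (phi (q p) \o q \o psi p) (phi p p).
Proof.
have [_ sq] := smooth_q.
exact: (nbhs_singleton (smooth_near_differentiable (sq p))).
Qed.

Lemma dmap_linear p c u v :
  dmap q p (c *: u + v) = c *: dmap q p u + dmap q p v.
Proof. exact/linear_derive/map_differentiable. Qed.

Lemma dmapD p u v : dmap q p (u + v) = dmap q p u + dmap q p v.
Proof. by rewrite -[u in LHS]scale1r dmap_linear scale1r. Qed.

Lemma dmapB p u v : dmap q p (u - v) = dmap q p u - dmap q p v.
Proof. by rewrite addrC -scaleN1r dmap_linear scaleN1r addrC. Qed.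

Lemma dmap_chart x p v : dom x (q p) ->
  triv (tangent N) x (q p) (dmap q p v) = mderiv (phi x \o q) p v.
Proof.
move=> xq; apply: etrans (tangent_trivE _ xq) _.
have e : phi (q p) (q p) = (phi (q p) \o q \o psi p) (phi p p).
  by rewrite /= phiK//; exact: dom_self.
rewrite e -derive_comp; last 2 first.
- exact: map_differentiable.
- by rewrite -e; apply: transition_differentiable => //; exact: dom_self.
apply: near_eq_derive.
have := near_psi (dom_self p) (near_map (near_dom (dom_self (q p)))).
by apply: filterS => w qw /=; rewrite phiK.
Qed.

Lemma multilinear_pullback k (beta : rform N k) : multilinear_form beta ->
  multilinear_form (pullback_form q beta : rform P k).
Proof.
move=> mb p; apply: multilinear_comp (mb (q p)) => c u v; exact: dmap_linear.
Qed.

Lemma alternating_pullback k (beta : rform N k) : alternating_form beta ->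
  alternating_form (pullback_form q beta : rform P k).
Proof. by move=> ab p X i j ij Xij; apply: (ab _ _ _ _ ij); rewrite Xij. Qed.

Section AtPoint.
Context (p : P).
Let g := phi (q p) \o q \o psi p.
Let z := phi p p.

Let smooth_g : smooth_near g z.
Proof. by have [_ sq] := smooth_q; exact: sq. Qed.

Let gz : g z = phi (q p) (q p).
Proof. by rewrite /g /z /= phiK//; exact: dom_self. Qed.

(** In the charts at [p] and [q p] the differential of [q] at nearby points is the
    derivative of one fixed map [g]. *)
Lemma dmap_local :
  \forall w \near z, forall v,
    dmap q (psi p w) (((triv (tangent P) p (psi p w))^-1)%VF v) =
    ((triv (tangent N) (q p) (q (psi p w)))^-1)%VF ('D_v g w).
Proof.
have pp := dom_self p.
have h1 := near_psiK pp.
have h2 := near_psi pp (near_map (near_dom (dom_self (q p)))).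
have h3 := smooth_near_differentiable smooth_g.
near=> w; move=> v.
have [pw wK] : dom p (psi p w) /\ phi p (psi p w) = w by near: w.
have qw : dom (q p) (q (psi p w)) by near: w.
have dg : differentiable g w by near: w.
have E : triv (tangent N) (q p) (q (psi p w))
    (dmap q (psi p w) (((triv (tangent P) p (psi p w))^-1)%VF v)) = 'D_v g w.
  apply: etrans (dmap_chart _ qw) _.
  apply: etrans (mderiv_chart _ pw _) _; first by rewrite wK; exact: dg.
  by rewrite wK (tangent_trivVK v pw).
by rewrite -[LHS](tangent_trivK _ qw) E.
Unshelve. all: by end_near. Qed.

Lemma local_form_pullback k (beta : rform N k) :
  \forall w \near z, forall v,
    local_form (pullback_form q beta : rform P k) p w v =
    local_form beta (q p) (g w) (fun j => 'D_(v j) g w).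
Proof.
have h2 := near_psi (dom_self p) (near_map (near_dom (dom_self (q p)))).
apply: filterS2 dmap_local h2 => w dw qw v.
rewrite /local_form /pullback_form /g /= phiK//; congr (beta _ _).
by apply/funext => j; exact: dw.
Qed.

Lemma is_derive_local_pullback k (beta : rform N k) v u : is_form beta ->
  is_derive z u (local_form (pullback_form q beta : rform P k) p ^~ v)
    ('D_(dmap q p u) (local_form beta (q p) ^~ (fun j => dmap q p (v j)))
       (phi (q p) (q p)) +
     \sum_j beta (q p) (upd (fun j => dmap q p (v j)) j ('D_u ('D_(v j) g) z))).
Proof.
move=> fb; apply: near_eq_is_derive.
  by apply: filterS (local_form_pullback beta) => w /(_ v) ->.
have db c : differentiable (local_form beta (q p) ^~ c) (g z).
  by rewrite gz; exact: is_form_differentiable.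
have dg : differentiable g z by exact: map_differentiable.
have dB c : is_derive z u (fun w => local_form beta (q p) (g w) c)
    ('D_(dmap q p u) (local_form beta (q p) ^~ c) (phi (q p) (q p))).
  have dBg := @differentiable_comp _ _ _ _ g (local_form beta (q p) ^~ c) z dg (db c).
  split; first exact: diff_derivable dBg.
  rewrite -gz; exact: (derive_comp u dg (db c)).
have dY j : derivable ('D_(v j) g) z u.
  apply: diff_derivable.
  exact: nbhs_singleton (smooth_near_differentiable (smooth_near_derive _ smooth_g)).
have [D E] := is_derive_multilinear
  (fun w => local_form_multilinear (q p) (g w) (is_form_multilinear fb))
  (fun c => @ex_derive _ _ _ _ _ _ _ (dB c)) dY.
split; [exact: D|apply: etrans E _].
have [_ E0] := dB (fun j => dmap q p (v j)).
apply: (f_equal2 (@GRing.add R^o)); first exact: E0.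
by apply: eq_bigr => j _; rewrite gz local_form_center.
Qed.

Lemma derivable_pullback k (beta : rform N k) : is_form beta ->
  derivable_form (pullback_form q beta : rform P k) p.
Proof. by move=> fb v u; have [] := is_derive_local_pullback v u fb. Qed.

(** The derivative of a pulled back coefficient has one term with a derivative of
    [beta], and terms with a second derivative of the chart expression of [q];
    the latter are symmetric and cancel in the alternating sum. *)
Lemma ext_d_pullback k (beta : rform N k) X : is_form beta ->
  ext_d (pullback_form q beta : rform P k) p X =
  ext_d beta (q p) (fun i => dmap q p (X i)).
Proof.
move=> fb; rewrite !ext_d_local.
pose H a b := 'D_(X a) ('D_(X b) g) z.
have H0 : altsum (beta (q p) : _ -> R^o) (fun i => dmap q p (X i)) H = 0.
  rewrite altsum_antisym; last 2 first.
  - exact: is_form_multilinear.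
  - exact: is_form_alternating.
  rewrite altsumB; last exact: is_form_multilinear.
  suff -> : (fun a b => H b a) = H by rewrite subrr mulr0.
  by do 2 (apply/funext => ?); exact: symmetric_smooth_derivative.
apply: etrans (addr0 _); apply: etrans (f_equal2 +%R erefl H0).
rewrite /altsum -big_split; apply: eq_bigr => i _ /=.
rewrite -mulrDr; apply: (f_equal2 *%R erefl).
by have [_ E] := is_derive_local_pullback (X \o lift i) (X i) fb; exact: E.
Qed.

End AtPoint.

End Pullback.

(** * Curvature of the horizontal distribution *)

Section BundleMaps.
Context (R : realType).

Lemma is_derive_scale (U : normedModType R) n (a : U -> R) (G : U -> 'rV[R]_n)
    z u (da : R) (dG : 'rV[R]_n) :
  is_derive z u a da -> is_derive z u G dG ->
  is_derive z u (fun y => a y *: G y) (a z *: dG + da *: G z).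
Proof.
move=> Da [DG EG].
have D i j : is_derive z u (fun y => (a y *: G y) i j : R)
    (a z * dG i j + da * G z i j).
  have Gij : is_derive z u (fun y => G y i j : R) (dG i j).
    split; first by have /derivable_mxP := DG; exact.
    by rewrite -EG derive_mx// mxE.
  have -> : (fun y => (a y *: G y) i j) = a * (fun y => G y i j : R).
    by apply/funext => y; rewrite mxE.
  have [D E] := is_deriveM Da Gij; split; first exact: D.
  by apply: etrans E _; rewrite [da * _]mulrC.
have DS : derivable (fun y => a y *: G y) z u.
  by apply/derivable_mxP => i j; have [] := D i j.
split => //; rewrite derive_mx//; apply/matrixP => i j.
by rewrite !mxE; have [_ E] := D i j; exact: E.
Qed.

Context (m r : nat) (P : manifold R m) (A : bundle_data P r).
Context (f : forall x, 'Hom(A x, 'rV[R]_m)).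

(** In the local frame of constant sections [e l], the image of [s] is the
    combination of the [f (e l)] with the coordinates of [s] as coefficients. As
    these vanish at [p], the derivatives of the [f (e l)] do not contribute. *)
Lemma is_derive_bundle_map (s : forall y, A y) p u :
  @bundle_map_smooth R m P r m A (tangent P) f ->
  (\forall y \near p, lker (triv A p y) = 0%VS /\ limg (triv A p y) = fullv) ->
  section_smooth_near s p -> s p = 0 ->
  is_derive (phi p p) u
    ((fun y => triv (tangent P) p y (f y (s y))) \o psi p)
    (f p (((triv A p p)^-1)%VF (mderiv (fun y => triv A p y (s y)) p u))).
Proof.
move=> sf bA ss s0; have pp := dom_self p.
have [_ lp] := nbhs_singleton bA.
pose e l := const_ext (((triv A p p)^-1)%VF (delta_mx ord0 l) : A p).
pose G l y := triv (tangent P) p y (f y (e l y)).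
pose sigma y := triv A p y (s y).
have eE l y : e l y = ((triv A p y)^-1)%VF (delta_mx ord0 l).
  by rewrite /e /const_ext limg_lfunVK// lp memvf.
have sE : \forall y \near p, \sum_l sigma y ord0 l *: G l y =
    triv (tangent P) p y (f y (s y)).
  apply: filterS bA => y [ky ly]; have /eqP ky0 := ky.
  have -> : s y = \sum_l sigma y ord0 l *: e l y.
    rewrite -[LHS](lker0_lfunK ky0) -/(sigma y) [in LHS](row_basis (sigma y)).
    by rewrite linear_sum; apply: eq_bigr => l _; rewrite linearZ eE.
  by rewrite !linear_sum; apply: eq_bigr => l _; rewrite !linearZ.
have dG l : derivable (G l \o psi p) (phi p p) u.
  apply: diff_derivable.
  have se : section_smooth_near (e l) p.
    by apply: const_ext_smooth; apply: filterS bA => y [].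
  exact: nbhs_singleton (smooth_near_differentiable (sf p (e l) se)).
have ds : derivable (sigma \o psi p) (phi p p) u.
  by apply: diff_derivable; exact: nbhs_singleton (smooth_near_differentiable ss).
have dsl l : is_derive (phi p p) u (fun w => sigma (psi p w) ord0 l : R)
    (mderiv sigma p u ord0 l).
  split; first by have /derivable_mxP := ds; exact.
  exact: (derive_coord l ds).
have D := is_derive_sum (fun l => is_derive_scale (dsl l) (derivableP (dG l))).
apply: (@near_eq_is_derive _ _ _ _ _ _ _ _ (near_psi pp sE)).
have -> : (fun w => \sum_l sigma (psi p w) ord0 l *: G l (psi p w)) =
    \sum_l (fun w => sigma (psi p w) ord0 l *: (G l \o psi p) w).
  by apply/funext => w; rewrite fct_sumE.
apply: (is_derive_eq D).
rewrite [in RHS](row_basis (mderiv sigma p u)) !linear_sum.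
apply: eq_bigr => l _; rewrite !linearZ /= phiK// /sigma s0 linear0 mxE scale0r add0r.
by rewrite /G tangent_triv_id eE.
Qed.

End BundleMaps.

Section Shear.
Context (R : realType) (n r m : nat) (M : manifold R n) (F : flat_bundle M r).
Context (omega : vform 2 F).
Context (P : manifold R m) (pi : P -> M).
Context (theta : vform 1 (pullback_bundle pi F)).
Context (rho : forall p : P, 'Hom(F (pi p), 'rV[R]_m)).
Context (hP : shear_total_space omega theta rho).

Let spi : smooth_map pi := leaf_smooth (total_leaf_space hP).

Lemma theta_linear p c (u v : 'rV[R]_m) :
  theta p (fun _ => c *: u + v) = c *: theta p (fun _ => u) + theta p (fun _ => v).
Proof.
have [lt _ _] := total_theta_form hP; have := lt p (fun _ => 0) ord0 c u v.
have E0 w : upd (fun _ : 'I_1 => 0) ord0 w = (fun _ => w) :> ('I_1 -> 'rV[R]_m).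
  by apply/funext => j; rewrite /upd ord1.
by rewrite !E0.
Qed.

Lemma thetaB p (u v : 'rV[R]_m) :
  theta p (fun _ => u - v) = theta p (fun _ => u) - theta p (fun _ => v).
Proof. by rewrite addrC -scaleN1r theta_linear scaleN1r addrC. Qed.

Lemma horizontal_proj p u :
  horizontal theta p (u - rho p (theta p (fun _ => u))).
Proof. by rewrite /horizontal /= thetaB (total_theta_rho hP) subrr. Qed.

Lemma dmap_horizontal_proj p u :
  dmap pi p (u - rho p (theta p (fun _ => u))) = dmap pi p u.
Proof. by rewrite dmapB// (total_rho_vertical hP) subr0. Qed.

Lemma horizontal_liftP p u :
  horizontal theta p (horizontal_lift theta p u) /\
  dmap pi p (horizontal_lift theta p u) = u.
Proof.
apply: (@getPex _ [set v | horizontal theta p v /\ dmap pi p v = u]).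
have [v <-] := leaf_submersion (total_leaf_space hP) p u.
by exists (v - rho p (theta p (fun _ => v))); split;
  [exact: horizontal_proj|exact: dmap_horizontal_proj].
Qed.

Lemma near_F_triv p : \forall p' \near p,
  lker (triv F (pi p) (pi p')) = 0%VS /\ limg (triv F (pi p) (pi p')) = fullv.
Proof.
have vF := flat_is_vector_bundle F.
have dF : \forall y \near pi p, tdom F (pi p) y.
  apply: open_nbhs_nbhs; split; first exact: (tdom_open vF).
  exact: (tdom_self vF).
apply: filterS (near_map spi dF) => p' d.
by split; [exact: (triv_inj vF)|exact: (triv_surj vF)].
Qed.

(** The section is zero, hence its own double. *)
Lemma nabla_const_ext0 x v : nabla F x v (const_ext (0 : F x)) = 0.
Proof.
have vF := flat_is_vector_bundle F.
have s0 : section_smooth_near (const_ext (0 : F x)) x.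
  apply: const_ext_smooth.
  have : open_nbhs x (tdom F x).
    by split; [exact: (tdom_open vF)|exact: (tdom_self vF)].
  by move=> /open_nbhs_nbhs; apply: filterS => y; exact: (triv_surj vF).
have := conn_add (flat_is_flat F) v s0 s0.
have -> : (fun y => const_ext (0 : F x) y + const_ext (0 : F x) y) =
    const_ext (0 : F x).
  by apply: functional_extensionality_dep => y; rewrite /const_ext !linear0 addr0.
by move=> /eqP; rewrite -subr_eq0 opprD addrA subrr sub0r oppr_eq0 => /eqP.
Qed.

Definition theta_section p (u : 'rV[R]_m) : forall p', pullback_bundle pi F p' :=
  fun p' => theta p' (fun _ : 'I_1 => const_ext (u : tangent P p) p').

Lemma theta_section_smooth p u : section_smooth_near (theta_section p u) p.
Proof.
have [_ _ st] := total_theta_form hP.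
apply: (st p (fun _ : 'I_1 => const_ext (u : tangent P p))) => _.
exact: const_ext_tangent_smooth.
Qed.

Lemma theta_section_center p u : horizontal theta p u -> theta_section p u p = 0.
Proof.
move=> hu; rewrite /theta_section const_ext_tangent.
rewrite -{1}(tangent_triv_id p u) tangent_trivK//; exact: dom_self.
Qed.

(** The structure equation [d theta = pi^* omega] on horizontal vectors. There
    [theta] takes the value zero at [p], so the connection terms drop out and only
    the derivatives of [theta] in the trivialization are left. *)
Lemma curvature_horizontal p u v :
  horizontal theta p u -> horizontal theta p v ->
  let d w w' := ((triv F (pi p) (pi p))^-1)%VF
    (mderiv (fun p' => triv F (pi p) (pi p') (theta_section p w' p')) p w) in
  d u v - d v u =
  omega (pi p) (fun i : 'I_2 => dmap pi p (if i == ord0 then u else v)).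
Proof.
move=> hu hv d.
have := total_curvature hP p (fun i : 'I_2 => if i == ord0 then u else v).
rewrite /pullback_form => <-; rewrite /ext_deriv !big_ord_recl big_ord0 addr0 /=.
rewrite expr0 scale1r expr1 scaleN1r.
(* the two summands of the exterior derivative of theta see the sections of v and u *)
pose pair (i : 'I_2) : 'rV[R]_m := if i == ord0 then u else v.
have sE (i : 'I_2) w : (forall j : 'I_1, pair (lift i j) = w) ->
    (fun y => theta y (fun j : 'I_1 =>
       @const_ext R m P m (tangent P) p (pair (lift i j)) y)) = theta_section p w.
  move=> iw; apply: functional_extensionality_dep => y; congr (theta y _).
  by apply/funext => j; rewrite iw.
have e0 := sE ord0 v (fun _ => erefl).
have e1 : (fun y => theta y (fun j : 'I_1 =>
    @const_ext R m P m (tangent P) p (pair (lift (lift ord0 ord0) j)) y)) =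
    theta_section p u.
  by apply: sE => j; rewrite /pair ifT// (ord1 j) -val_eqE.
rewrite /pair in e0 e1; rewrite e0.
rewrite e1 /pullback_connection !theta_section_center//.
apply: (f_equal2 (fun x y => x - y)); apply: esym.
  by apply: etrans (f_equal2 +%R erefl (nabla_const_ext0 _ _)) _; rewrite addr0.
by apply: etrans (f_equal2 +%R erefl (nabla_const_ext0 _ _)) _; rewrite addr0.
Qed.

End Shear.

(** * The exterior derivative of the difference of related forms *)

Section VconsLinear.
Context (R : realType) (n : nat).

Lemma vcons_linear k (B : ('I_k.+1 -> 'rV[R]_n) -> R^o) X c u v :
  multilinear B ->
  B (vcons (c *: u + v) X) = c *: B (vcons u X) + B (vcons v X).
Proof.
move=> mB; rewrite -(vcons_upd X 0 (c *: u + v)) mB.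
by rewrite !vcons_upd.
Qed.

Lemma vconsN k (B : ('I_k.+1 -> 'rV[R]_n) -> R^o) X u :
  multilinear B -> B (vcons (- u) X) = - B (vcons u X).
Proof. by move=> mB; rewrite -(vcons_upd X 0 (- u)) multilinearN// vcons_upd. Qed.

Lemma vcons0 k (B : ('I_k.+1 -> 'rV[R]_n) -> R^o) X :
  multilinear B -> B (vcons 0 X) = 0.
Proof. by move=> mB; rewrite -(vcons_upd X 0 0) multilinear0. Qed.

Lemma map_vcons m k (L : 'rV[R]_m -> 'rV[R]_n) u (X : 'I_k -> 'rV[R]_m) :
  (fun i => L (vcons u X i)) = vcons (L u) (fun i => L (X i)).
Proof. by apply/funext => i; rewrite /vcons; case: unlift. Qed.

Lemma contractE (N : manifold R n) r k (V : bundle_data N r)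
    (zeta : forall x, 'Hom(V x, 'rV[R]_n)) (beta : rform N k.+1) x X e :
  multilinear_form beta ->
  contract zeta beta x X e = beta x (vcons (zeta x e) X).
Proof.
move=> mb; rewrite /contract linfunE// => c u v.
by rewrite linearP; exact: vcons_linear.
Qed.

Section Difference.
Context (N : manifold R n) (k : nat) (b1 b2 : rform N k).

Definition subform : rform N k := fun x X => (b1 x X : R^o) - b2 x X.

Lemma multilinear_sub : multilinear_form b1 -> multilinear_form b2 ->
  multilinear_form subform.
Proof.
move=> m1 m2 x X i c u v; rewrite /subform m1 m2 scalerBr opprD.
by rewrite addrACA.
Qed.

Lemma alternating_sub : alternating_form b1 -> alternating_form b2 ->
  alternating_form subform.
Proof.
move=> a1 a2 x X i j ij Xij.
by rewrite /subform (a1 _ _ _ _ ij Xij) (a2 _ _ _ _ ij Xij) subr0.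
Qed.

Lemma is_derive_sub x v u : derivable_form b1 x -> derivable_form b2 x ->
  is_derive (phi x x) u (local_form subform x ^~ v)
    ('D_u (local_form b1 x ^~ v) (phi x x) -
     'D_u (local_form b2 x ^~ v) (phi x x)).
Proof.
move=> d1 d2; exact: is_deriveB (derivableP (d1 v u)) (derivableP (d2 v u)).
Qed.

Lemma derivable_sub x : derivable_form b1 x -> derivable_form b2 x ->
  derivable_form subform x.
Proof. by move=> d1 d2 v u; have [] := is_derive_sub v u d1 d2. Qed.

Lemma ext_d_sub x X : derivable_form b1 x -> derivable_form b2 x ->
  ext_d subform x X = (ext_d b1 x X : R^o) - ext_d b2 x X.
Proof.
move=> d1 d2; rewrite !ext_d_local -sumrB; apply: eq_bigr => i _.
rewrite -mulrBr; apply: (f_equal2 *%R erefl).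
by have [_ E] := is_derive_sub (X \o lift i) (X i) d1 d2; exact: E.
Qed.

End Difference.

End VconsLinear.

Section Defect.
Context (R : realType) (n m s : nat).
Context (M : manifold R n) (P : manifold R m) (S : manifold R s).
Context (pi : P -> M) (smooth_pi : smooth_map pi).
Context (piS : P -> S) (smooth_piS : smooth_map piS).
Context (k : nat) (alpha : rform M k) (halpha : is_form alpha).
Context (alphaS : rform S k) (halphaS : is_form alphaS).

Definition defect : rform P k :=
  subform (pullback_form piS alphaS : rform P k) (pullback_form pi alpha : rform P k).

Lemma defect_multilinear : multilinear_form defect.
Proof.
by apply: multilinear_sub; apply: multilinear_pullback => //;
  exact: is_form_multilinear.
Qed.

Lemma defect_alternating : alternating_form defect.
Proof.
by apply: alternating_sub; apply: alternating_pullback; exact: is_form_alternating.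
Qed.

Lemma defect_derivable p : derivable_form defect p.
Proof. by apply: derivable_sub; exact: derivable_pullback. Qed.

Lemma ext_d_defect p X :
  ext_d defect p X = (ext_d alphaS (piS p) (fun i => dmap piS p (X i)) : R^o) -
    ext_d alpha (pi p) (fun i => dmap pi p (X i)).
Proof.
rewrite ext_d_sub; try exact: derivable_pullback.
by rewrite (ext_d_pullback smooth_piS _ _ halphaS) (ext_d_pullback smooth_pi _ _ halpha).
Qed.

End Defect.

Section ShearForms.
Context (R : realType) (n r m s : nat) (M : manifold R n) (E F : flat_bundle M r).
Context (xi : forall x : M, 'Hom(E x, 'rV[R]_n)) (a : forall x : M, 'Hom(E x, F x)).
Context (omega : vform 2 F) (hdata : shear_data xi a omega).
Context (P : manifold R m) (pi : P -> M).
Context (theta : vform 1 (pullback_bundle pi F)).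
Context (rho : forall p : P, 'Hom(F (pi p), 'rV[R]_m)).
Context (hP : shear_total_space omega theta rho).
Context (S : manifold R s) (piS : P -> S).
Context (hS : is_shear xi a theta rho piS).

Let spi : smooth_map pi := leaf_smooth (total_leaf_space hP).
Let spiS : smooth_map piS := leaf_smooth hS.

(** The vertical part of the bracket of two horizontal fields, up to sign. *)
Definition curvature_vector p (u v : 'rV[R]_m) : 'rV[R]_m :=
  rho p (omega (pi p) (fun i : 'I_2 => dmap pi p (if i == ord0 then u else v))).

Section AnyDegree.
Context (k : nat) (alpha : rform M k) (halpha : is_form alpha).
Context (alphaS : rform S k) (halphaS : is_form alphaS).
Context (hrel : H_related theta piS alpha alphaS).

(** The derivative at [p] of the horizontal field [Y j] is that of its vertical part
    [- V j]; antisymmetrized, it is minus the curvature. *)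
Lemma ext_d_defect_altsum p X : (forall i, horizontal theta p (X i)) ->
  ext_d (defect pi piS alpha alphaS) p X =
  - (2^-1 * altsum (defect pi piS alpha alphaS p : _ -> R^o) X
    (fun x y => - curvature_vector p (X x) (X y))) :> R.
Proof.
move=> hX.
pose V j p' : 'rV[R]_m := triv (tangent P) p p' (rho p' (theta_section theta p (X j) p')).
pose Y j w : 'rV[R]_m := X j - V j (psi p w).
have DV j u : is_derive (phi p p) u (V j \o psi p)
   (rho p (((triv F (pi p) (pi p))^-1)%VF
     (mderiv (fun p' => triv F (pi p) (pi p') (theta_section theta p (X j) p')) p u))).
  apply: (@is_derive_bundle_map R m r P (pullback_bundle pi F) rho
    (theta_section theta p (X j)) p u).
  - exact: (total_rho_smooth hP).
  - exact: (near_F_triv hP).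
  - exact: (theta_section_smooth hP).
  - exact: theta_section_center.
have DY j u := is_deriveB (is_derive_cst (X j) (phi p p) u) (DV j u).
have pp := dom_self p.
rewrite (@ext_d_vanishing _ _ P k (defect pi piS alpha alphaS) p X Y).
- rewrite altsum_antisym; last 2 first.
    exact: defect_multilinear.
    exact: defect_alternating.
  congr (- (_ * altsum _ _ _)); apply/funext => x; apply/funext => y.
  have [_ ->] := DY y (X x); have [_ ->] := DY x (X y).
  have C := curvature_horizontal hP (hX x) (hX y).
  have alg (u v : 'rV[R]_m) : 0 - u - (0 - v) = - (u - v).
    by rewrite !sub0r opprK opprB addrC.
  rewrite /curvature_vector -C; apply: etrans (alg _ _) _.
  by apply: (f_equal -%R); rewrite [RHS]linearB.
- exact: defect_multilinear.
- exact: defect_derivable.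
- by move=> j u; have [] := DY j u.
- by move=> j; rewrite /Y /V phiK// theta_section_center// !linear0 addr0.
- move=> i; apply: filterS (near_psiK pp) => w [pw wK].
  have hrel' Z : (forall j, horizontal theta (psi p w) (Z j)) ->
      defect pi piS alpha alphaS (psi p w) Z = 0.
    by move=> hZ; rewrite /defect /subform (hrel hZ) subrr.
  apply: hrel' => j; rewrite /Y /V linearB /= tangent_trivK//.
  rewrite -const_ext_tangent; exact: (horizontal_proj hP).
Qed.

End AnyDegree.

(** [xi_ring e] is the sum of the horizontal lift of [xi e] and of [rho (a e)], and
    it is tangent to the leaves that [piS] collapses. *)
Lemma dmapS_rho p (f : F (pi p)) :
  dmap piS p (rho p f) =
  - dmap piS p (horizontal_lift theta p (xi (pi p) (((a (pi p))^-1)%VF f))).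
Proof.
set e := ((a (pi p))^-1)%VF f.
have fE : f = a (pi p) e by rewrite limg_lfunVK// (shear_a_surj hdata) memvf.
have : range (xi_ring xi a theta rho (p := p))
    (xi_ring xi a theta rho (p := p) e) by exists e.
move=> /(leaf_tangent hS); rewrite /xi_ring -fE; set u := horizontal_lift _ _ _.
move=> h0; apply: (addrI (dmap piS p u)); rewrite subrr -dmapD//; exact: h0.
Qed.

Context (j : nat) (alpha : rform M j.+1) (halpha : is_form alpha).
Context (alphaS : rform S j.+1) (halphaS : is_form alphaS).
Context (hrel : H_related theta piS alpha alphaS).

(** Replacing [rho f] by the opposite of a horizontal lift does not change the
    value of [piS^* alphaS], which can then be compared with [pi^* alpha]; and
    [pi^* alpha] itself vanishes on [rho f]. *)
Lemma defect_rho p (f : F (pi p)) (Y : 'I_j -> 'rV[R]_m) :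
  (forall i, horizontal theta p (Y i)) ->
  defect pi piS alpha alphaS p (vcons (rho p f) Y) =
  - alpha (pi p) (vcons (xi (pi p) (((a (pi p))^-1)%VF f))
                        (fun i => dmap pi p (Y i))) :> R^o.
Proof.
move=> hY; rewrite /defect /subform /pullback_form !map_vcons.
rewrite (total_rho_vertical hP) dmapS_rho.
set u := horizontal_lift _ _ _.
have [hu du] := horizontal_liftP hP p (xi (pi p) (((a (pi p))^-1)%VF f)).
have mS : multilinear (alphaS (piS p) : _ -> R^o) by exact: is_form_multilinear.
have mM : multilinear (alpha (pi p) : _ -> R^o) by exact: is_form_multilinear.
rewrite (vconsN _ _ mS) (vcons0 _ mM) subr0.
have huY i : horizontal theta p (vcons u Y i).
  by rewrite /vcons; case: unlift.
have := hrel huY; rewrite /pullback_form !map_vcons du => EE.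
by rewrite EE.
Qed.

(** The factor [2^-1] left by antisymmetrization is the [2!^-1] in the
    normalization of the wedge product. *)
Lemma contract_wedge_shuffle p (X : 'I_j.+2 -> 'rV[R]_m) :
  (forall i, horizontal theta p (X i)) ->
  contract_wedge (fun y : M => (xi y \o (a y)^-1)%VF) omega alpha (pi p)
    (fun i => dmap pi p (X i)) =
  2^-1 * altsum (defect pi piS alpha alphaS p : _ -> R^o) X
    (fun x y => - curvature_vector p (X x) (X y)) :> R.
Proof.
move=> hX; rewrite altsum_shuffle; last 2 first.
- exact: (defect_multilinear spi spiS halpha halphaS).
- exact: (defect_alternating pi piS halpha halphaS).
rewrite mulrA -invfM -natrM -[2%N]/(2`!) mulnC.
rewrite /contract_wedge /wedge_pairing /shuffle_sum.
congr (_ * _); apply: eq_bigr => sg _; congr (_ * _).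
rewrite contractE; last exact: is_form_multilinear.
rewrite comp_lfunE /curvature_vector -linearN defect_rho; last by move=> i; exact: hX.
set f := omega _ _; set f' := omega _ _.
have -> : f' = f.
  rewrite /f /f'; congr (omega _ _); apply/funext => i; congr (dmap _ _ _).
  case: (unliftP ord0 i) => [i' ->|->]; last by [].
  by rewrite ord1; congr (X (sg _)); apply: val_inj.
have -> : xi (pi p) (((a (pi p))^-1)%VF (- f)) = - xi (pi p) (((a (pi p))^-1)%VF f).
  by rewrite 2!linearN.
have mA : multilinear (alpha (pi p) : _ -> R^o) by exact: is_form_multilinear.
by rewrite (vconsN _ _ mA) opprK.
Qed.

End ShearForms.

Theorem corollary3p11 (R : realType) (n r m s k : nat)
  (M : manifold R n) (E F : flat_bundle M r)
  (xi : forall x : M, 'Hom(E x, 'rV[R]_n))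
  (a : forall x : M, 'Hom(E x, F x))
  (omega : vform 2 F)
  (hdata : shear_data xi a omega)
  (P : manifold R m) (pi : P -> M)
  (theta : vform 1 (pullback_bundle pi F))
  (rho : forall p : P, 'Hom(F (pi p), 'rV[R]_m))
  (hP : shear_total_space omega theta rho)
  (S : manifold R s) (piS : P -> S)
  (hS : is_shear xi a theta rho piS)
  (alpha : rform M k) (halpha : is_form alpha)
  (hL : forall (x : M) (X : 'I_k -> 'rV[R]_n),
    lie_deriv (nabla E) (@real_connection R n M) xi alpha x X = 0)
  (alphaS : rform S k) (halphaS : is_form alphaS)
  (hrel : H_related theta piS alpha alphaS) :
  H_related theta piS
    (fun x X => ext_d alpha x X -
       contract_wedge (fun y : M => (xi y \o (a y)^-1)%VF) omega alpha x X)
    (ext_d alphaS).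
Proof.
move=> p X hX; rewrite /pullback_form.
have spi := leaf_smooth (total_leaf_space hP); have spiS := leaf_smooth hS.
have := ext_d_defect_altsum hP hS halpha halphaS hrel hX.
rewrite (ext_d_defect spi spiS halpha halphaS).
have -> : 2^-1 * altsum (defect pi piS alpha alphaS p : _ -> R^o) X
    (fun x y => - curvature_vector omega rho p (X x) (X y)) =
    contract_wedge (fun y : M => (xi y \o (a y)^-1)%VF) omega alpha (pi p)
    (fun i => dmap pi p (X i)).
  (* for a 0-form both sides are zero: there is no argument to vary *)
  case: k alpha halpha hL alphaS halphaS hrel X hX => [|j] al hal _ alS halS rel X hX.
    by rewrite /altsum big1 ?mulr0// => i _; rewrite big_ord0 mulr0.
  exact: esym (contract_wedge_shuffle hdata hP hS hal halS rel hX).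
by move=> /eqP; rewrite subr_eq addrC => /eqP ->.
Qed.
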